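(* For a partition $\Pi=\{0=t_0<t_1<t_2<\cdots\}$ of $[0,\infty)$ with $t_j\uparrow\infty$ and $|\Pi|=\sup_j(t_j-t_{j-1})<\infty$, let $$V_\Pi(t)=\sum_{j=1}^{N(t)}|F(t_j)-F(t_{j-1})|^4,\qquad N(t)=\max\{j:t_j\le t\}.$$ Then for all $T>0$, $$\lim_{|\Pi|\to0}E\left[\sup_{0\le t\le T}\left|V_\Pi(t)-\frac{6}{\pi}t\right|^2\right]=0.$$
   Context: Let $W$ be a space-time white noise on $[0,\infty)\times\mathbb{R}$, i.e. a centered Gaussian random measure whose Wiener integrals satisfy $E[\int g\,dW\int h\,dW]=\int gh$ for $g,h\in L^2([0,\infty)\times\mathbb{R})$. Let $p(t,x)=(2\pi t)^{-1/2}e^{-x^2/2t}$, fix $x\in\mathbb{R}$, and let $$F(t)=\int_{[0,t]\times\mathbb{R}}p(t-r,x-y)\,W(dr\times dy),\qquad t\ge 0,$$ a centered Gaussian process, taken in a continuous modification. (Thus $F(t)=u(t,x)$ where $u$ is the solution of the stochastic heat equation $u_t=\frac12u_{xx}+\dot W$ with $u(0,\cdot)\equiv0$.) *)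

(* Defs.v *)
From HB Require Import structures.
From mathcomp Require Import all_boot all_order all_algebra.
From mathcomp Require Import all_classical all_reals all_analysis.

Set Implicit Arguments.
Unset Strict Implicit.
Unset Printing Implicit Defensive.

Import Order.TTheory GRing.Theory Num.Theory.
Import numFieldNormedType.Exports.

Local Open Scope classical_set_scope.
Local Open Scope ring_scope.

Notation spacetime R := (measurableTypeR R * measurableTypeR R)%type.

Notation leb2 R := (@lebesgue_measure R \x @lebesgue_measure R)%E.

(* [0, oo) x R, with time as the first coordinate *)
Definition halfplane (R : realType) : set (spacetime R) :=
  [set z | 0 <= z.1].

Definition noise_set (R : realType) (A : set (spacetime R)) : Prop :=
  [/\ measurable A, A `<=` @halfplane R & (leb2 R A < +oo)%E].

(* [normal_prob 0 0] is not a point mass in the library, hence the separate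
   degenerate case *)
Definition centered_gaussian (R : realType) (d : measure_display)
    (Omega : measurableType d) (P : probability Omega R)
    (X : Omega -> R) : Prop :=
  measurable_fun setT X /\
  ({ae P, forall w, X w = 0} \/
   exists2 s : R, 0 < s & forall B : set (measurableTypeR R), measurable B ->
     P (X @^-1` B) = normal_prob 0 s B).

Definition square_integrable (R : realType) (g : spacetime R -> R) : Prop :=
  measurable_fun (@halfplane R) g /\
  (\int[leb2 R]_(z in @halfplane R) (g z ^+ 2)%:E < +oo)%E.

(* [X] is a version of the Wiener integral of [g] with respect to [W]: the
   limit in L^2(P) of the integrals of some simple functions that converge to
   [g] in L^2([0, oo) x R) *)
Definition wiener_integral (R : realType) (d : measure_display)
    (Omega : measurableType d) (P : probability Omega R)
    (W : set (spacetime R) -> Omega -> R)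
    (g : spacetime R -> R) (X : Omega -> R) : Prop :=
  [/\ square_integrable g,
      measurable_fun setT X &
      exists (m : nat -> nat) (c : nat -> nat -> R)
             (A : nat -> nat -> set (spacetime R)),
        [/\ forall n k, noise_set (A n k),
            (\int[leb2 R]_(z in @halfplane R)
               ((\sum_(k < m n) c n k * \1_(A n k) z - g z) ^+ 2)%:E)%E
              @[n --> \oo] --> 0%E &
            (\int[P]_w
               ((\sum_(k < m n) c n k * W (A n k) w - X w) ^+ 2)%:E)%E
              @[n --> \oo] --> 0%E]].

(* The values of [W] outside [noise_set] are irrelevant. *)
Record white_noise (R : realType) (d : measure_display)
    (Omega : measurableType d) (P : probability Omega R)
    (W : set (spacetime R) -> Omega -> R) : Prop := WhiteNoise {
  white_noise_gaussian : forall (n : nat) (c : nat -> R)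
      (A : nat -> set (spacetime R)),
    (forall k, noise_set (A k)) ->
    centered_gaussian P (fun w => \sum_(k < n) c k * W (A k) w) ;
  white_noise_sigma_additive : forall A : nat -> set (spacetime R),
    (forall k, noise_set (A k)) -> trivIset setT A ->
    noise_set (\bigcup_k A k) ->
    (\int[P]_w
       ((\sum_(k < n) W (A k) w - W (\bigcup_k A k) w) ^+ 2)%:E)%E
      @[n --> \oo] --> 0%E ;
  white_noise_isometry : forall (g h : spacetime R -> R) (X Y : Omega -> R),
    wiener_integral P W g X -> wiener_integral P W h Y ->
    'E_P[(fun w => X w * Y w)%R]%E =
    (\int[leb2 R]_(z in @halfplane R) (g z * h z)%:E)%E }.

Definition heat_kernel (R : realType) (t x : R) : R :=
  (Num.sqrt (2 * pi * t))^-1 * expR (- (x ^+ 2 / (2 * t))).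

(* The integrand defining F(t). On the null set r = t the value is 0, since
   division by 0 gives 0. *)
Definition heat_integrand (R : realType) (x t : R) (z : spacetime R) : R :=
  if (0 <= z.1) && (z.1 <= t) then heat_kernel (t - z.1) (x - z.2) else 0.

Definition heat_process (R : realType) (d : measure_display)
    (Omega : measurableType d) (P : probability Omega R)
    (W : set (spacetime R) -> Omega -> R) (x : R)
    (F : R -> Omega -> R) : Prop :=
  (forall t, 0 <= t -> wiener_integral P W (heat_integrand x t) (F t)) /\
  (forall w, {within `[0, +oo[, continuous (fun t => F t w)}).

Definition mesh (R : realType) (p : nat -> R) : \bar R :=
  ereal_sup (range (fun j => (p j.+1 - p j)%:E)).

Record time_partition (R : realType) := TimePartition {
  knot :> nat -> R ;
  knot0 : knot 0%N = 0 ;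
  knot_lt : forall j, knot j < knot j.+1 ;
  knot_cvg : knot n @[n --> \oo] --> +oo ;
  knot_mesh : (mesh knot < +oo)%E }.

(* N(t) = max {j : t_j <= t} *)
Definition knot_count (R : realType) (p : time_partition R) (t : R) : nat :=
  xget 0%N [set n | p n <= t /\ forall m, p m <= t -> (m <= n)%N].

Definition quartic_variation (R : realType) (Omega : Type)
    (F : R -> Omega -> R) (p : time_partition R) (t : R) (w : Omega) : R :=
  \sum_(1 <= j < (knot_count p t).+1) `|F (p j) w - F (p j.-1) w| ^+ 4.

(* Main.v *)
Require Import Defs.
From HB Require Import structures.
From mathcomp Require Import all_boot all_order all_algebra.
From mathcomp Require Import all_classical all_reals all_analysis.
From mathcomp Require Import measurable_realfun.
From mathcomp Require Import ring lra.
Import Order.TTheory GRing.Theory Num.Theory.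
Import numFieldNormedType.Exports.
Local Open Scope classical_set_scope.
Local Open Scope ring_scope.

(** Since the law of F is centred Gaussian, everything reduces to the covariance
    of F and to fourth and eighth moments.

    The isometry turns E[F(s) F(t)] into an inner product of heat kernels.
    Integrating first in space (the semigroup property) and then in time gives
    (sqrt(s+t) - sqrt|t-s|) / sqrt(2 pi).  For an increment X over [a, b] this
    yields Var X = sqrt(2(b-a)/pi) - err, where err is nonnegative and at most
    (sqrt(2b) - sqrt(2a)) / sqrt(2 pi), a telescoping quantity.  Hence
    E[X^4] = 3 (Var X)^2 is (6/pi)(b-a) up to an error which, summed over a
    partition, is O(sqrt of the mesh) ([knot_var_bias]).

    The fluctuations are controlled by a sign.  By concavity of the square root,
    increments over disjoint intervals have nonpositive covariance
    ([heat_incr_cov_le0]), while the covariance of an increment with F(t_n) is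
    nonnegative.  So for each increment the absolute covariances with all the
    others sum to at most its own variance ([sum_norm_knot_cov]).  As
    Cov(X^4, Y^4) = 72 Var X Var Y r^2 + 24 r^4 with r = E[XY], the variance of
    the sum of the X_i^4 is at most 192 |mesh| t ([quartic_variance_le]).  This
    gives the convergence of V(t) in L^2 for each fixed t, with an explicit rate
    ([quartic_variation_L2]).  The variation V is nondecreasing in t and its limit
    is linear, so a finite grid of times controls the supremum
    ([sqr_deviation_le_grid]).

    The random variables F(t) are only known as L^2 limits of combinations of the
    noise.  The property of X that is used is that
    E[X^4] = 3 E[X^2]^2 and E[X^8] = 105 E[X^2]^4 ([gaussian_moments]).  It passes
    to L^2 limits because differences of approximants are Gaussian too, so that
    an L^2 Cauchy sequence is Cauchy in L^8 ([gaussian_moments_L2_limit]).  The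
    mixed moment E[X^4 Y^4] is recovered from the eighth moments of the
    combinations aX + bY ([Rintegral_pow4_pow4]), so that joint laws never
    appear. *)

Set Implicit Arguments.
Unset Strict Implicit.
Unset Printing Implicit Defensive.

(** * Moments of the centred normal law *)

(** The measure nu has density g with respect to mu, so it is absolutely
    continuous and its Radon-Nikodym derivative agrees with g almost everywhere. *)
Lemma integral_density (R : realType) (d : measure_display) (T : measurableType d)
    (nu : {finite_measure set T -> \bar R})
    (mu : {sigma_finite_measure set T -> \bar R})
    (g : T -> R) (f : T -> \bar R) :
  (forall x, 0 <= g x) -> measurable_fun setT g ->
  (forall B, measurable B -> nu B = (\int[mu]_(x in B) (g x)%:E)%E) ->
  (forall x, 0 <= f x)%E -> measurable_fun setT f ->
  (\int[nu]_x f x = \int[mu]_x (f x * (g x)%:E))%E.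
Proof.
move=> g0 mg nuE f0 mf.
have numu : nu `<< mu.
  apply/null_content_dominatesP => A mA A0; rewrite nuE//.
  by apply: null_set_integral => //; exact/measurable_EFinP/measurable_funTS.
rewrite -(Radon_Nikodym_SigmaFinite.change_of_variables numu)//.
have RNi := Radon_Nikodym_SigmaFinite.f_integrable numu.
apply: ae_eq_integral => //.
- by apply: emeasurable_funM => //; exact: measurable_int RNi.
- by apply: emeasurable_funM => //; exact/measurable_EFinP.
apply: ae_eqe_mul2l.
apply: integral_ae_eq => //.
- exact/measurable_EFinP.
- by move=> E _ mE; rewrite -nuE// -Radon_Nikodym_SigmaFinite.f_integral.
Qed.

Lemma integral_gaussian_law (R : realType) (d : measure_display)
    (Omega : measurableType d) (P : probability Omega R) (X : Omega -> R)
    (s : R) (f : R -> \bar R) :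
  measurable_fun setT X ->
  (forall B : set (measurableTypeR R), measurable B ->
     P (X @^-1` B) = normal_prob 0 s B) ->
  (forall x, 0 <= f x)%E -> measurable_fun setT f ->
  (\int[P]_w f (X w) =
   \int[@lebesgue_measure R]_x (f x * (normal_pdf 0 s x)%:E))%E.
Proof.
move=> mX XE f0 mf.
have mX' : @measurable_fun _ _ _ (measurableTypeR R) setT X by [].
rewrite -(@integral_density R _ _ (normal_prob 0 s))//; last 2 first.
- by move=> x; exact: normal_pdf_ge0.
- exact: measurable_normal_pdf.
pose X' : {mfun Omega >-> measurableTypeR R} :=
  HB.pack (X : Omega -> measurableTypeR R)
    (isMeasurableFun.Build _ _ Omega (measurableTypeR R) X mX').
transitivity (\int[pushforward P X']_x f x)%E.
  by rewrite ge0_integral_pushforward//= preimage_setT.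
by apply: eq_measure_integral => B mB _; exact: XE.
Qed.

(** The boundary terms of the integrations by parts below vanish at infinity. *)
Lemma powX_normal_pdf_cvg0 (R : realType) (s : R) (k : nat) : 0 < s ->
  (n%:R ^+ k * normal_pdf 0 s n%:R) @[n --> \oo] --> (0 : R).
Proof.
move=> s0; have s0' : s != 0 by rewrite gt_eqF.
(* C comes from expR y >= y ^+ k.+1 / k.+1`! at y = x ^+ 2 / (2 s ^+ 2) *)
pose C : R := (2 * s ^+ 2) ^+ k.+1 * (k.+1)`!%:R * normal_peak s.
have C0 : 0 <= C.
  apply: mulr_ge0; last exact: normal_peak_ge0.
  by rewrite mulr_ge0// exprn_ge0// mulr_ge0// sqr_ge0.
have ub n : n.+1%:R ^+ k * normal_pdf 0 s n.+1%:R <= C * n.+1%:R^-1.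
  rewrite normal_pdfE// /normal_fun subr0.
  set x : R := n.+1%:R; have x1 : 1 <= x by rewrite ler1n.
  have x0 : 0 < x by exact: lt_le_trans x1.
  rewrite mulNr expRN.
  set y := x ^+ 2 / (s ^+ 2 *+ 2).
  have s2 : 0 < s ^+ 2 *+ 2 by rewrite mulrn_wgt0// exprn_gt0.
  have y0 : 0 < y by rewrite divr_gt0// exprn_gt0.
  have ey : y ^+ k.+1 / (k.+1)`!%:R <= expR y.
    by apply: le_trans (expR_ge1Dxn k (ltW y0)); rewrite lerDr.
  have yk0 : 0 < y ^+ k.+1 / (k.+1)`!%:R.
    by rewrite divr_gt0 ?exprn_gt0// ltr0n fact_gt0.
  apply: (@le_trans _ _ (x ^+ k * (normal_peak s * (y ^+ k.+1 / (k.+1)`!%:R)^-1))).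
    apply: ler_wpM2l; first by rewrite exprn_ge0// ltW.
    apply: ler_wpM2l; first exact: normal_peak_ge0.
    by rewrite lef_pV2 // posrE expR_gt0.
  have -> : x ^+ k * (normal_peak s * (y ^+ k.+1 / (k.+1)`!%:R)^-1) =
    C * (x ^+ k / (x ^+ 2) ^+ k.+1).
    rewrite /C /y expr_div_n -(mulr_natl (s ^+ 2)) !invf_div.
    ring.
  rewrite ler_wpM2l// -exprM mul2n -addnn addSn exprS.
  rewrite ler_pdivrMr; last by rewrite mulr_gt0// exprn_gt0.
  by rewrite mulKf ?gt_eqF// ler_weXn2l// leq_addr.
rewrite -cvg_shiftS.
apply: (@squeeze_cvgr _ _ _ _ (cst 0) (fun n => C * n.+1%:R^-1)).
- near=> n; rewrite ub andbT mulr_ge0 ?exprn_ge0 ?normal_pdf_ge0//.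
- exact: cvg_cst.
- rewrite -[X in _ --> X](mulr0 C); apply: cvgMr.
  exact: cvg_harmonic.
Unshelve. all: by end_near. Qed.

Lemma is_derive_powX_normal_pdf (R : realType) (s x : R) (k : nat) : 0 < s ->
  is_derive x (1:R) (fun y : R => y ^+ k.+1 * normal_pdf 0 s y)
    ((k.+1%:R * x ^+ k - x ^+ k.+2 / s ^+ 2) * normal_pdf 0 s x).
Proof.
move=> s0; have s0' : s != 0 by rewrite gt_eqF.
rewrite normal_pdfE// /normal_fun.
have h : is_derive x (1:R) (fun y : R => - (y - 0) ^+ 2 / (s ^+ 2 *+ 2))
    (- x / s ^+ 2).
  apply: is_derive_eq.
  by rewrite /GRing.scale/= subr0 -mulr_natl; field.
have he := @is_derive1_comp R expR _ x _ _ (is_derive_expR _) h.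
have hX : is_derive x (1:R) (fun y : R => y ^+ k.+1) (k.+1%:R * x ^+ k).
  have := @is_deriveX _ _ id k.+1 x 1 1 (is_derive_id _ _).
  by rewrite exprfctE /GRing.scale/= mulr1.
apply: is_derive_eq; rewrite /GRing.scale/=.
by move: (expR _) => e; rewrite !exprS; field.
Qed.

Lemma continuous_powX_normal_pdf (R : realType) (s : R) (k : nat) : 0 < s ->
  continuous (fun x : R => x ^+ k * normal_pdf 0 s x).
Proof.
move=> s0 x; apply: cvgM; first exact: exprn_continuous.
by apply: continuous_normal_pdf; rewrite gt_eqF.
Qed.

(** The recursion E[X^(k+2)] = (k+1) s^2 E[X^k] is an integration by parts:
    x^(k+1) phi(x) has derivative (k+1) x^k phi(x) - x^(k+2) phi(x) / s^2, and it
    is integrated over [-n, n].  As k is even both integrands are nonnegative, so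
    monotone convergence lets n tend to infinity. *)
Lemma normal_moment_step (R : realType) (s : R) (k : nat) (m : R) :
  0 < s -> ~~ odd k ->
  (\int[@lebesgue_measure R]_x (x ^+ k * normal_pdf 0 s x)%:E = m%:E ->
  \int[@lebesgue_measure R]_x (x ^+ k.+2 * normal_pdf 0 s x)%:E =
    (k.+1%:R * s ^+ 2 * m)%:E)%E.
Proof.
move=> s0 k_even intk; have s0' : s != 0 by rewrite gt_eqF.
pose I (j n : nat) : \bar R := (\int[@lebesgue_measure R]_(x in `[(- n%:R)%R, n%:R]%classic)
  (x ^+ j * normal_pdf 0 s x)%:E)%E.
have ge0 j (x : R) : ~~ odd j -> 0 <= x ^+ j * normal_pdf 0 s x.
  by move=> j_even; rewrite mulr_ge0 ?normal_pdf_ge0// exprn_even_ge0.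
have mp j : measurable_fun setT (fun x : R => (x ^+ j * normal_pdf 0 s x)).
  apply: continuous_measurable_fun.
  exact: (@continuous_powX_normal_pdf _ _ j s0).
have k2 : ~~ odd k.+2 by rewrite /= negbK.
have Icvg j : ~~ odd j -> I j n @[n --> \oo] -->
    (\int[@lebesgue_measure R]_x (x ^+ j * normal_pdf 0 s x)%:E)%E.
  move=> j_even.
  have -> : [set: measurableTypeR R] = \bigcup_n (`[(- n%:R)%R, n%:R]%classic : set R).
    apply/seteqP; split => // x _; exists (Num.truncn `|x|).+1 => //=; rewrite in_itv/= -ler_norml.
    by rewrite ltW// truncnS_gt.
  apply: ge0_nondecreasing_set_cvg_integral => //.
  - move=> a b ab; apply/subsetPset => x/=.
    rewrite !in_itv/= => /andP[xa ax].
    have ab' : a%:R <= b%:R :> R by rewrite ler_nat.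
    by rewrite (le_trans _ xa) ?lerN2// (le_trans ax).
  - move=> n; apply/measurable_EFinP; apply: measurable_funTS; exact: mp.
  - by move=> n x _; rewrite lee_fin ge0.
have Ifin j n : I j n \is a fin_num.
  apply: integrable_fin_num => //.
  apply: continuous_compact_integrable; first exact: segment_compact.
  by apply: continuous_subspaceT; exact: continuous_powX_normal_pdf.
have rel n : I k.+2 n.+1 = ((k.+1%:R * s ^+ 2)%:E * I k n.+1
    - (2 * s ^+ 2 * (n.+1%:R ^+ k.+1 * normal_pdf 0 s n.+1%:R))%:E)%E.
  pose b : R := n.+1%:R.
  have b0 : 0 < b by rewrite ltr0n.
  have F j := is_derive_powX_normal_pdf (s := s) _ j s0.
  have cF x : {for x, continuous (fun y : R => y ^+ k.+1 * normal_pdf 0 s y)}.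
    exact: (@continuous_powX_normal_pdf _ _ k.+1 s0).
  have intb j : (@lebesgue_measure R).-integrable `[- b, b]
      (EFin \o (fun x => x ^+ j * normal_pdf 0 s x)).
    apply: continuous_compact_integrable; first exact: segment_compact.
    by apply: continuous_subspaceT; exact: continuous_powX_normal_pdf.
  have ftc : (\int[@lebesgue_measure R]_(x in `[(- b)%R, b])
      (k.+1%:R * (x ^+ k * normal_pdf 0 s x) -
       (s ^+ 2)^-1 * (x ^+ k.+2 * normal_pdf 0 s x))%:E =
      (b ^+ k.+1 * normal_pdf 0 s b)%:E -
      ((- b) ^+ k.+1 * normal_pdf 0 s (- b))%:E)%E.
    apply: (@continuous_FTC2 R _ (fun x => x ^+ k.+1 * normal_pdf 0 s x)).
    - by rewrite gtrN.
    - apply: continuous_subspaceT => x; apply: cvgB; apply: cvgMr;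
        exact: continuous_powX_normal_pdf.
    - split.
      + by move=> x _; have [] := F x k.
      + by apply: cvg_at_right_filter; exact: cF.
      + by apply: cvg_at_left_filter; exact: cF.
    - move=> x _; rewrite derive1E; have [_ ->] := F x k.
      ring.
  move: ftc; rewrite integralB_EFin//; last 2 first.
  - exact: (integrableZl _ _ (intb k)).
  - exact: (integrableZl _ _ (intb k.+2)).
  under eq_integral do rewrite EFinM.
  under [X in (_ - X)%E]eq_integral do rewrite EFinM.
  rewrite integralZl//; last exact: (intb k).
  rewrite integralZl//; last exact: (intb k.+2).
  have -> : (- b) ^+ k.+1 * normal_pdf 0 s (- b) = - (b ^+ k.+1 * normal_pdf 0 s b).
    by rewrite exprNn -signr_odd /= k_even normal_pdfE// /normal_fun !subr0 sqrrN expr1 mulN1r mulNr.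
  have := Ifin k n.+1; have := Ifin k.+2 n.+1; rewrite /I -/b.
  move=> /fineK <- /fineK <-; rewrite -!EFinM -!EFinB => -[eqI]; congr EFin.
  have e : forall u v w : R, k.+1%:R * u - (s ^+ 2)^-1 * v = w - - w ->
     v = k.+1%:R * s ^+ 2 * u - 2 * s ^+ 2 * w.
    by move=> u v w h; have -> : v = s ^+ 2 * (k.+1%:R * u - (k.+1%:R * u - (s ^+ 2)^-1 * v));
      [field|rewrite h; ring].
  exact: e.
have A := Icvg _ k2; have B : I k.+2 n @[n --> \oo] --> ((k.+1%:R * s ^+ 2)%:E * m%:E - 0)%E.
  rewrite -cvg_shiftS/=; under eq_fun do rewrite rel.
  have h1 : ((k.+1%:R * s ^+ 2)%:E * I k n.+1)%E @[n --> \oo] -->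
      ((k.+1%:R * s ^+ 2)%:E * m%:E)%E.
    apply: cvgeZl => //; have := Icvg k k_even.
    by rewrite intk -(cvg_shiftS (I k)).
  have h2 : (2 * s ^+ 2 * (n.+1%:R ^+ k.+1 * normal_pdf 0 s n.+1%:R))%:E
      @[n --> \oo] --> 0%E.
    apply: cvg_EFin; first exact: nearW.
    rewrite /comp/= -[X in _ --> X](mulr0 (2 * s ^+ 2)); apply: cvgMr.
    rewrite (cvg_shiftS (fun n => n%:R ^+ k.+1 * normal_pdf 0 s n%:R)).
    exact: powX_normal_pdf_cvg0.
  by have := cvgeB _ h1 h2; apply.
by have := cvg_unique _ A B; rewrite sube0 -EFinM; exact.
Qed.

(** The only trace of Gaussianity used below; the law of X itself is not
    mentioned, which makes the property easy to carry to L^2 limits. *)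
Definition gaussian_moments (R : realType) (d : measure_display)
    (Omega : measurableType d) (P : probability Omega R) (X : Omega -> R) : Prop :=
  measurable_fun setT X /\ exists2 v : R, 0 <= v &
    [/\ \int[P]_w (X w ^+ 2)%:E = v%:E, \int[P]_w (X w ^+ 4)%:E = (3 * v ^+ 2)%:E
      & \int[P]_w (X w ^+ 8)%:E = (105 * v ^+ 4)%:E]%E.

Lemma centered_gaussian_moments (R : realType) (d : measure_display)
    (Omega : measurableType d) (P : probability Omega R) (X : Omega -> R) :
  centered_gaussian P X -> gaussian_moments P X.
Proof.
move=> [mX [X0|[s s0 XE]]]; split => //.
  exists 0 => //.
  have int0 j : (\int[P]_w (X w ^+ j.+1)%:E = 0)%E.
    rewrite (ae_eq_integral (cst 0%E))//.
    - by rewrite integral0.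
    - exact/measurable_EFinP/measurable_funX.
    - by apply: filterS X0 => w + _ => ->; rewrite expr0n.
  by rewrite !int0 !expr0n !mulr0; split.
exists (s ^+ 2); first exact: sqr_ge0.
have E j : ~~ odd j -> (\int[P]_w (X w ^+ j)%:E =
    \int[@lebesgue_measure R]_x (x ^+ j * normal_pdf 0 s x)%:E)%E.
  move=> j_even.
  rewrite (integral_gaussian_law (f := fun x => (x ^+ j)%:E) mX XE)//.
    by move=> x; rewrite lee_fin exprn_even_ge0.
  by apply/measurable_EFinP; exact: exprn_measurable.
have m0 : (\int[@lebesgue_measure R]_x (x ^+ 0 * normal_pdf 0 s x)%:E = 1%:E)%E.
  by under eq_integral do rewrite expr0 mul1r; rewrite integral_normal_pdf.
have m2 := normal_moment_step (k := 0) s0 isT m0.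
have m4 := normal_moment_step (k := 2) s0 isT m2.
have m6 := normal_moment_step (k := 4) s0 isT m4.
have m8 := normal_moment_step (k := 6) s0 isT m6.
rewrite !E//; split; [rewrite m2|rewrite m4|rewrite m8];
  congr EFin; ring.
Qed.

(** * Moments of L^2 limits of Gaussian variables *)

(** The convex function u^8 lies above its tangent at v; the proof exhibits the
    difference as a sum of squares. *)
Lemma pow8_tangent (R : realType) (u v : R) : 8 * v ^+ 7 * (u - v) <= u ^+ 8 - v ^+ 8.
Proof.
rewrite -subr_ge0.
have -> : u ^+ 8 - v ^+ 8 - 8 * v ^+ 7 * (u - v) =
  (u ^+ 4 - v ^+ 4) ^+ 2 + 2 * v ^+ 4 * (u ^+ 2 - v ^+ 2) ^+ 2
  + 4 * v ^+ 6 * (u - v) ^+ 2 by ring.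
have p j (a b c : R) : 0 <= c -> ~~ odd j -> 0 <= c * a ^+ j * b ^+ 2.
  by move=> c0 hj; rewrite mulr_ge0 ?sqr_ge0// mulr_ge0// exprn_even_ge0.
by rewrite !addr_ge0 ?sqr_ge0 ?p.
Qed.

Lemma cvge0_near_le (R : realType) (f : nat -> \bar R) (eps : R) : 0 < eps ->
  f n @[n --> \oo] --> 0%E -> \forall n \near \oo, (f n <= eps%:E)%E.
Proof.
move=> e0 /fine_cvgP[ffin f0].
near=> n.
have fn : f n \is a fin_num by near: n.
rewrite -(fineK fn) lee_fin.
apply: le_trans (ler_norm _) _.
near: n; move/cvgr0Pnorm_le : f0; exact.
Unshelve. all: by end_near. Qed.

(** A Fatou lemma along L^2 convergence, obtained without extracting an almost
    surely convergent subsequence.  On the set where |D| <= K, convexity gives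
    D^8 <= Dn^8 + 8 K^7 |Dn - D|, and the last term is small in mean; then K
    tends to infinity. *)
Lemma integral_pow8_le_L2_limit (R : realType) (d : measure_display)
    (Omega : measurableType d) (P : probability Omega R)
    (Dn : nat -> Omega -> R) (D : Omega -> R) (c : R) :
  (forall n, measurable_fun setT (Dn n)) -> measurable_fun setT D ->
  (\int[P]_w ((Dn n w - D w) ^+ 2)%:E)%E @[n --> \oo] --> 0%E ->
  (\forall n \near \oo, (\int[P]_w (Dn n w ^+ 8)%:E <= c%:E)%E) ->
  (\int[P]_w (D w ^+ 8)%:E <= c%:E)%E.
Proof.
move=> mDn mD D2 Dc.
pose S (K : nat) := [set w | `|D w| <= K%:R].
have mS K : measurable (S K).
  rewrite -[S K]setTI; apply: measurable_fun_le => //.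
  exact: measurableT_comp.
have STE : [set: Omega] = \bigcup_K S K.
  apply/seteqP; split => // w _; exists (Num.truncn `|D w|).+1 => //=.
  by rewrite /S/= ltW// truncnS_gt.
have pow8_ge0 (x : R) : 0 <= x ^+ 8 by rewrite exprn_even_ge0.
have mD8 A : measurable_fun A (fun w => (D w ^+ 8)%:E).
  by apply/measurable_EFinP; apply: measurable_funTS; exact: measurable_funX.
have cvgS : (\int[P]_(w in S K) (D w ^+ 8)%:E)%E @[K --> \oo] -->
    (\int[P]_w (D w ^+ 8)%:E)%E.
  rewrite STE; apply: ge0_nondecreasing_set_cvg_integral => //.
  - move=> a b ab; apply/subsetPset => w; rewrite /S/= => /le_trans; apply.
    by rewrite ler_nat.
  - by move=> i x _; rewrite lee_fin.
apply: (cvge_to_le cvgS); apply: nearW => K.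
apply/lee_addgt0Pr => eta eta0.
(* C makes 8 K ^+ 7 |x| <= eta / 2 + C x ^+ 2, by completing the square *)
pose C : R := 16 * K%:R ^+ 14 / (eta / 2).
have C0 : 0 <= C.
  by rewrite /C divr_ge0 ?mulr_ge0 ?exprn_ge0 ?ler0n// ltW// divr_gt0.
have C10 : 0 < eta / 2 / (C + 1) by rewrite !divr_gt0// ltr_wpDl.
have [n [Dnc Dn2]] : exists n, (\int[P]_w (Dn n w ^+ 8)%:E <= c%:E)%E /\
   (\int[P]_w ((Dn n w - D w) ^+ 2)%:E <= (eta / 2 / (C + 1))%:E)%E.
  have [n] := filter_ex (filterI Dc (cvge0_near_le C10 D2)).
  by exists n.
have mDD : measurable_fun setT (fun w => (Dn n w - D w) ^+ 2).
  by apply: measurable_funX; exact: measurable_funB.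
apply: (@le_trans _ _ (\int[P]_w ((Dn n w ^+ 8)%:E +
    ((eta / 2)%:E + C%:E * ((Dn n w - D w) ^+ 2)%:E)))%E).
  apply: (@le_trans _ _ (\int[P]_(w in S K) ((Dn n w ^+ 8)%:E +
    ((eta / 2)%:E + C%:E * ((Dn n w - D w) ^+ 2)%:E)))%E).
    apply: ge0_le_integral => //.
    - by move=> w _; rewrite lee_fin.
    - apply/measurable_EFinP; apply: measurable_funTS; apply: measurable_funD.
        exact: measurable_funX.
      by apply: measurable_funD => //; exact: measurable_funM.
    move=> w Sw; rewrite -EFinM -!EFinD lee_fin.
    have := pow8_tangent (Dn n w) (D w).
    have : - (eta / 2 + C * (Dn n w - D w) ^+ 2) <= 8 * D w ^+ 7 * (Dn n w - D w).
      have h0 : 0 < eta / 2 by rewrite divr_gt0.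
      have : (D w ^+ 7) ^+ 2 <= K%:R ^+ 14.
        rewrite -exprM -(ger0_norm (exprn_even_ge0 _ _))// normrX.
        by rewrite lerXn2r ?nnegrE.
      move: (D w ^+ 7) (Dn n w - D w) => v x vK.
      rewrite -subr_ge0.
      have -> : 8 * v * x - - (eta / 2 + C * x ^+ 2) =
          (4 * v * x + eta / 2) ^+ 2 / (eta / 2)
          + 16 * (K%:R ^+ 14 - v ^+ 2) / (eta / 2) * x ^+ 2.
        by rewrite /C; field; rewrite gt_eqF.
      apply: addr_ge0; first by rewrite divr_ge0 ?sqr_ge0// ltW.
      by rewrite mulr_ge0 ?sqr_ge0// divr_ge0 ?(ltW h0)// mulr_ge0// subr_ge0.
    lra.
  apply: ge0_subset_integral => //.
    apply/measurable_EFinP; apply: measurable_funD; first exact: measurable_funX.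
    by apply: measurable_funD => //; exact: measurable_funM.
  move=> w _; rewrite -EFinM -!EFinD lee_fin addr_ge0// addr_ge0 ?(mulr_ge0 C0 (sqr_ge0 _))//.
  by rewrite ltW// divr_gt0.
rewrite ge0_integralD//; last 4 first.
- by move=> w _; rewrite lee_fin.
- by apply/measurable_EFinP; exact: measurable_funX.
- by move=> w _; rewrite -EFinM -EFinD lee_fin addr_ge0 ?(mulr_ge0 C0 (sqr_ge0 _))// ltW// divr_gt0.
- apply/measurable_EFinP; apply: measurable_funD => //.
  exact: measurable_funM.
apply: leeD => //.
rewrite ge0_integralD//; last 3 first.
- by move=> w _; rewrite lee_fin ltW// divr_gt0.
- by move=> w _; rewrite -EFinM lee_fin mulr_ge0// sqr_ge0.
- by apply/measurable_EFinP; exact: measurable_funM.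
rewrite integral_cst// ge0_integralZl//; last 2 first.
- exact/measurable_EFinP.
- by move=> w _; rewrite lee_fin sqr_ge0.
rewrite /= probability_setT mule1.
have -> : eta%:E = ((eta / 2)%:E + (eta / 2)%:E)%E.
  by rewrite -EFinD; congr EFin; field.
apply: leeD => //.
apply: (@le_trans _ _ (C%:E * (eta / 2 / (C + 1))%:E)%E).
  exact: lee_wpmul2l.
have C1 : 0 < C + 1 by rewrite ltr_wpDl.
rewrite -EFinM lee_fin mulrA ler_pdivrMr// mulrDr mulr1 mulrC lerDl.
by rewrite ltW// divr_gt0.
Qed.

Lemma integral_le_lincomb (R : realType) (d : measure_display) (T : measurableType d)
    (mu : {measure set T -> \bar R}) (f g h : T -> R) (a b : R) :
  measurable_fun setT f -> measurable_fun setT g -> measurable_fun setT h ->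
  (forall x, 0 <= f x) -> (forall x, 0 <= g x) -> (forall x, 0 <= h x) ->
  0 <= a -> 0 <= b -> (forall x, f x <= a * g x + b * h x) ->
  (\int[mu]_x (f x)%:E <=
    a%:E * \int[mu]_x (g x)%:E + b%:E * \int[mu]_x (h x)%:E)%E.
Proof.
move=> mf mg mh f0 g0 h0 a0 b0 fgh.
have mE (k : T -> R) : measurable_fun setT k -> measurable_fun setT (fun x => (k x)%:E).
  by move=> mk; exact/measurable_EFinP.
have E0 (k : T -> R) : (forall x, 0 <= k x) -> forall x, setT x -> (0 <= (k x)%:E)%E.
  by move=> k0 x _; rewrite lee_fin.
have mZ (c : R) (k : T -> R) : measurable_fun setT k -> measurable_fun setT (fun x => c * k x).
  by move=> mk; exact: measurable_funM.
rewrite -ge0_integralZl//; [|exact: mE|exact: E0].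
rewrite -ge0_integralZl//; [|exact: mE|exact: E0].
rewrite -ge0_integralD//.
- apply: ge0_le_integral => //.
  + exact: E0.
  + exact: mE.
  + under eq_fun do rewrite -!EFinM -EFinD.
    by apply: mE; apply: measurable_funD; exact: mZ.
  + by move=> x _; rewrite -!EFinM -EFinD lee_fin.
- by move=> x _; rewrite mule_ge0// lee_fin.
- by under eq_fun do rewrite -EFinM; apply: mE; exact: mZ.
- by move=> x _; rewrite mule_ge0// lee_fin.
- by under eq_fun do rewrite -EFinM; apply: mE; exact: mZ.
Qed.

Lemma near_le_cvge0 (R : realType) (f : nat -> \bar R) :
  (forall n, 0 <= f n)%E ->
  (forall eps, 0 < eps -> \forall n \near \oo, (f n <= eps%:E)%E) ->
  f n @[n --> \oo] --> 0%E.
Proof.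
move=> f0 fe; apply/fine_cvgP; split.
  near=> n; rewrite ge0_fin_numE//.
  by apply: (@le_lt_trans _ _ 1%:E); [near: n; exact: fe|exact: ltry].
apply/cvgr0Pnorm_le => e e0; near=> n.
have fn : (f n <= e%:E)%E by near: n; exact: fe.
have ff : f n \is a fin_num by rewrite ge0_fin_numE// (le_lt_trans fn)// ltry.
by rewrite /= ger0_norm ?fine_ge0// -lee_fin fineK.
Unshelve. all: by end_near. Qed.

(** A perturbation inequality for the power p: if u - v is small in L^p then the
    p-th moments of u and v are close.  Unlike Minkowski's inequality it needs no
    p-th roots, and squaring it doubles p. *)
Definition pow_close (R : realType) (p : nat) : Prop :=
  forall eta : R, 0 < eta -> exists2 C : R, 0 <= C & forall u v : R,
    `|u ^+ p - v ^+ p| <= eta * v ^+ p + C * (u - v) ^+ p.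

Lemma pow_close2 (R : realType) : pow_close R 2.
Proof.
move=> eta eta0; exists (eta^-1 + 1); first by rewrite addr_ge0// invr_ge0 ltW.
move=> u v.
have -> : eta * v ^+ 2 + (eta^-1 + 1) * (u - v) ^+ 2 =
   (eta * v ^+ 2 + eta^-1 * (u - v) ^+ 2) + (u - v) ^+ 2 by ring.
have -> : u ^+ 2 - v ^+ 2 = 2 * v * (u - v) + (u - v) ^+ 2 by ring.
apply: le_trans (ler_normD _ _) _.
rewrite (ger0_norm (sqr_ge0 (u - v))) lerD2r.
move: (u - v) => x.
rewrite ler_norml; apply/andP; split; rewrite -subr_ge0.
  have -> : 2 * v * x - - (eta * v ^+ 2 + eta^-1 * x ^+ 2) = eta * (v + eta^-1 * x) ^+ 2.
    by field; rewrite gt_eqF.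
  by rewrite (mulr_ge0 (ltW eta0))// sqr_ge0.
have -> : eta * v ^+ 2 + eta^-1 * x ^+ 2 - 2 * v * x = eta * (v - eta^-1 * x) ^+ 2.
  by field; rewrite gt_eqF.
by rewrite (mulr_ge0 (ltW eta0))// sqr_ge0.
Qed.

(** Applying the quadratic case to u^p and v^p leaves (u^p - v^p)^2, which
    the hypothesis bounds by a small multiple of v^(2p) plus a multiple of
    (u - v)^(2p). *)
Lemma pow_close_double (R : realType) (p : nat) : ~~ odd p ->
  pow_close R p -> pow_close R (2 * p).
Proof.
move=> p_even pc eta eta0.
have eta20 : 0 < eta / 2 by rewrite divr_gt0.
have [C2 C20 h2] := @pow_close2 R (eta / 2) eta20.
have C21 : 0 < 4 * (C2 + 1) by rewrite mulr_gt0// ltr_wpDl.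
(* e <= 1 gives e ^+ 2 <= e, so that 2 C2 e ^+ 2 <= eta / 2 *)
pose e := Num.min 1 (eta / (4 * (C2 + 1))).
have e0 : 0 < e by rewrite lt_min ltr01 divr_gt0.
have e1 : e <= 1 by rewrite ge_min lexx.
have e2 : e * (4 * (C2 + 1)) <= eta by rewrite -ler_pdivlMr// ge_min lexx orbT.
have [C C0 h] := pc e e0.
exists (2 * C2 * C ^+ 2) => [|u v]; first by rewrite !mulr_ge0.
rewrite ![_ ^+ (2 * p)]exprM ![(_ ^+ 2) ^+ p]exprAC.
apply: le_trans (h2 _ _) _.
have V0 : 0 <= v ^+ p by rewrite exprn_even_ge0.
have D0 : 0 <= (u - v) ^+ p by rewrite exprn_even_ge0.
have sq : (u ^+ p - v ^+ p) ^+ 2 <= (e * v ^+ p + C * (u - v) ^+ p) ^+ 2.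
  rewrite -real_normK ?num_real//; apply: lerXn2r (h u v); rewrite nnegrE//.
  by rewrite addr_ge0 ?mulr_ge0// ltW.
move: (u ^+ p) (v ^+ p) ((u - v) ^+ p) V0 D0 sq => U V D V0 D0 sq.
have sq2 : (e * V + C * D) ^+ 2 <= 2 * e ^+ 2 * V ^+ 2 + 2 * C ^+ 2 * D ^+ 2.
  rewrite -subr_ge0 (_ : _ - _ = (e * V - C * D) ^+ 2) ?sqr_ge0//; ring.
have e3 : e ^+ 2 <= e by rewrite expr2 ler_piMl// ltW.
have e4 : 2 * C2 * e ^+ 2 <= eta / 2.
  apply: (@le_trans _ _ (2 * C2 * e)); first by rewrite ler_wpM2l// mulr_ge0.
  by move: e2; lra.
have : C2 * (U - V) ^+ 2 <= C2 * (2 * e ^+ 2 * V ^+ 2 + 2 * C ^+ 2 * D ^+ 2).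
  by apply: ler_wpM2l => //; exact: le_trans sq sq2.
have : 2 * C2 * e ^+ 2 * V ^+ 2 <= eta / 2 * V ^+ 2.
  by apply: ler_wpM2r => //; exact: sqr_ge0.
lra.
Qed.

(** Closeness with eta = 1 first bounds the p-th moment of X; closeness around X,
    whose moment is fixed, then bounds the difference of the moments. *)
Lemma cvg_integral_pow (R : realType) (d : measure_display) (T : measurableType d)
    (mu : {measure set T -> \bar R}) (p : nat) (Y : nat -> T -> R) (X : T -> R)
    (a : nat -> R) :
  ~~ odd p -> pow_close R p ->
  (forall n, measurable_fun setT (Y n)) -> measurable_fun setT X ->
  (forall n, \int[mu]_w (Y n w ^+ p)%:E = (a n)%:E)%E ->
  (\int[mu]_w ((Y n w - X w) ^+ p)%:E)%E @[n --> \oo] --> 0%E ->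
  exists2 l : R, (\int[mu]_w (X w ^+ p)%:E = l%:E)%E & a n @[n --> \oo] --> l.
Proof.
move=> p_even pc mY mX aE YX.
have pow0 (x : R) : 0 <= x ^+ p by rewrite exprn_even_ge0.
have mp (f : T -> R) : measurable_fun setT f -> measurable_fun setT (fun w => f w ^+ p).
  by move=> mf; exact: measurable_funX.
have mYX n : measurable_fun setT (fun w => Y n w - X w) by exact: measurable_funB.
have [l lE] : exists l : R, (\int[mu]_w (X w ^+ p)%:E = l%:E)%E.
  have [n n1] := filter_ex (cvge0_near_le ltr01 YX).
  have [C C0 h] := pc 1 ltr01.
  exists (fine (\int[mu]_w (X w ^+ p)%:E)%E); rewrite fineK//.
  rewrite ge0_fin_numE; last by apply: integral_ge0 => w _; rewrite lee_fin.
  apply: (@le_lt_trans _ _ (2%:E * (a n)%:E + C%:E * 1%:E)%E); last by rewrite -EFinM ltry.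
  apply: (@le_trans _ _ (2%:E * (a n)%:E + C%:E *
      (\int[mu]_w ((Y n w - X w) ^+ p)%:E))%E); last first.
    by rewrite leeD2l// lee_wpmul2l.
  rewrite -aE; apply: integral_le_lincomb => //; try exact: mp.
  move=> w; have := h (X w) (Y n w); rewrite ler_norml => /andP[_].
  rewrite -[(X w - Y n w)]opprB exprNn -signr_odd (negbTE p_even) expr0 !mul1r.
  lra.
exists l => //.
apply/cvgrPdist_le => e e0.
have l0 : 0 <= l by rewrite -lee_fin -lE; apply: integral_ge0 => w _; rewrite lee_fin.
have l1 : 0 < l + 1 by rewrite ltr_wpDl.
have [C C0 h] := pc (e / 2 / (l + 1)) (divr_gt0 (divr_gt0 e0 (ltr0n _ 2)) l1).
have C1 : 0 < C + 1 by rewrite ltr_wpDl.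
have eC : 0 < e / 2 / (C + 1) by rewrite !divr_gt0.
near=> n.
have n1 : (\int[mu]_w ((Y n w - X w) ^+ p)%:E <= (e / 2 / (C + 1))%:E)%E.
  by near: n; exact: cvge0_near_le.
pose et := e / 2 / (l + 1); pose tot := et * l + C * (e / 2 / (C + 1)).
have et0 : 0 <= et by rewrite /et !divr_ge0// ltW.
have tot_le : tot <= e.
  have : et * l <= e / 2.
    by rewrite /et mulrAC ler_pdivrMr// ler_wpM2l ?lerDl// ltW// divr_gt0.
  have : C * (e / 2 / (C + 1)) <= e / 2.
    by rewrite mulrA ler_pdivrMr// mulrC ler_wpM2l ?lerDl// ltW// divr_gt0.
  rewrite /tot; lra.
have DC : (C%:E * \int[mu]_w ((Y n w - X w) ^+ p)%:E <= (C * (e / 2 / (C + 1)))%:E)%E.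
  by rewrite EFinM lee_wpmul2l.
pose h' w := et * X w ^+ p + C * (Y n w - X w) ^+ p.
have mh' : measurable_fun setT h'.
  by apply: measurable_funD; apply: measurable_funM => //; exact: mp.
have h'0 w : 0 <= h' w by rewrite /h' addr_ge0// mulr_ge0.
have ih' : (\int[mu]_w (h' w)%:E <= tot%:E)%E.
  apply: (@le_trans _ _ (et%:E * \int[mu]_w (X w ^+ p)%:E +
      C%:E * \int[mu]_w ((Y n w - X w) ^+ p)%:E)%E).
    by apply: integral_le_lincomb => //; exact: mp.
  by rewrite /tot lE -EFinM EFinD leeD2l.
have close w : `|Y n w ^+ p - X w ^+ p| <= h' w by exact: h.
have up : (\int[mu]_w (Y n w ^+ p)%:E <= 1%:E * \int[mu]_w (X w ^+ p)%:E +
    1%:E * \int[mu]_w (h' w)%:E)%E.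
  apply: integral_le_lincomb => //; try exact: mp.
  by move=> w; have := close w; rewrite ler_norml => /andP[_]; lra.
have lo : (\int[mu]_w (X w ^+ p)%:E <= 1%:E * \int[mu]_w (Y n w ^+ p)%:E +
    1%:E * \int[mu]_w (h' w)%:E)%E.
  apply: integral_le_lincomb => //; try exact: mp.
  by move=> w; have := close w; rewrite ler_norml => /andP[+ _]; lra.
have {}up : a n <= l + tot.
  rewrite -lee_fin -aE (le_trans up)// lE !mul1e EFinD; exact: leeD2l.
have {}lo : l <= a n + tot.
  rewrite -lee_fin -lE (le_trans lo)// aE !mul1e EFinD; exact: leeD2l.
by rewrite ler_norml; move: up lo tot_le; lra.
Unshelve. all: by end_near. Qed.

(** The differences Y n - Y m satisfy E[(Y n - Y m)^8] = 105 E[(Y n - Y m)^2]^4,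
    so letting m tend to infinity yields convergence of Y n to X in L^8, hence in
    L^4, and all three moments pass to the limit. *)
Lemma gaussian_moments_L2_limit (R : realType) (d : measure_display)
    (Omega : measurableType d) (P : probability Omega R)
    (Y : nat -> Omega -> R) (X : Omega -> R) :
  (forall n, gaussian_moments P (Y n)) ->
  (forall n m, gaussian_moments P (fun w => Y n w - Y m w)) ->
  measurable_fun setT X ->
  (\int[P]_w ((Y n w - X w) ^+ 2)%:E)%E @[n --> \oo] --> 0%E ->
  gaussian_moments P X.
Proof.
move=> gY gYY mX YX.
have mY n : measurable_fun setT (Y n) by have [] := gY n.
have mYX n : measurable_fun setT (fun w => Y n w - X w) by exact: measurable_funB.
have pow0 j (x : R) : ~~ odd j -> 0 <= x ^+ j by move=> ?; rewrite exprn_even_ge0.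
have [v vP] : {v : nat -> R & forall n, [/\ (0 <= v n)%R,
    \int[P]_w (Y n w ^+ 2)%:E = (v n)%:E, \int[P]_w (Y n w ^+ 4)%:E = (3 * v n ^+ 2)%:E
    & \int[P]_w (Y n w ^+ 8)%:E = (105 * v n ^+ 4)%:E]%E}.
  apply: (@choice _ _ (fun n v => [/\ (0 <= v)%R,
    \int[P]_w (Y n w ^+ 2)%:E = v%:E, \int[P]_w (Y n w ^+ 4)%:E = (3 * v ^+ 2)%:E
    & \int[P]_w (Y n w ^+ 8)%:E = (105 * v ^+ 4)%:E]%E)) => n.
  by have [_ [x x0 [? ? ?]]] := gY n; exists x.
have YX8 : (\int[P]_w ((Y n w - X w) ^+ 8)%:E)%E @[n --> \oo] --> 0%E.
  apply: near_le_cvge0 => [n|t t0].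
    by apply: integral_ge0 => w _; rewrite lee_fin pow0.
  (* e is small enough for 105 (4 e) ^+ 4 <= t, as e ^+ 4 <= e *)
  pose k : R := 105 * 4 ^+ 4.
  have k0 : 0 < k by rewrite mulr_gt0// exprn_gt0.
  pose e := Num.min 1 (t / k).
  have e0 : 0 < e by rewrite lt_min ltr01 divr_gt0.
  have e1 : e <= 1 by rewrite ge_min lexx.
  have e2 : 105 * (4 * e) ^+ 4 <= t.
    rewrite exprMn mulrA -/k; apply: (@le_trans _ _ (k * e)).
      by rewrite ler_pM2l// ler_iXnr// ltW.
    by rewrite mulrC -ler_pdivlMr// ge_min lexx orbT.
  have YXe := cvge0_near_le e0 YX.
  apply: filterS YXe => n Yne.
  apply: (@le_trans _ _ (105 * (4 * e) ^+ 4)%:E); last by rewrite lee_fin.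
  apply: (@integral_pow8_le_L2_limit _ _ _ _ (fun m w => Y n w - Y m w)) => //.
  - by move=> m; exact: measurable_funB.
  - apply: cvg_trans YX; apply: near_eq_cvg; apply: nearW => m.
    by apply: eq_integral => w _; congr EFin; ring.
  - apply: filterS (cvge0_near_le e0 YX) => m Yme.
    have [_ [x x0 [x2 _ ->]]] := gYY n m.
    rewrite lee_fin ler_pM2l//; apply: lerXn2r; rewrite ?nnegrE//.
      by rewrite mulr_ge0// ltW.
    rewrite -lee_fin -x2.
    apply: (@le_trans _ _ (2%:E * \int[P]_w ((Y n w - X w) ^+ 2)%:E +
       2%:E * \int[P]_w ((Y m w - X w) ^+ 2)%:E)%E).
      apply: integral_le_lincomb => //; try by move=> *; rewrite sqr_ge0.
      + by apply: measurable_funX; exact: measurable_funB.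
      + exact: measurable_funX.
      + exact: measurable_funX.
      + move=> w; rewrite -subr_ge0 (_ : _ - _ = (Y n w + Y m w - 2 * X w) ^+ 2) ?sqr_ge0//.
        ring.
    have -> : 4 * e = 2 * e + 2 * e by ring.
    by rewrite [leRHS]EFinD; apply: leeD; rewrite EFinM lee_wpmul2l.
have YX4 : (\int[P]_w ((Y n w - X w) ^+ 4)%:E)%E @[n --> \oo] --> 0%E.
  apply: near_le_cvge0 => [n|t t0].
    by apply: integral_ge0 => w _; rewrite lee_fin pow0.
  have t2 : 0 < t ^+ 2 / 2 by rewrite divr_gt0// exprn_gt0.
  apply: filterS (cvge0_near_le t2 YX8) => n Yn8.
  apply: (@le_trans _ _ ((t / 2)%:E * \int[P]_w (1 : R)%:E +
       t^-1%:E * \int[P]_w ((Y n w - X w) ^+ 8)%:E)%E).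
    apply: integral_le_lincomb => //; try by move=> *; rewrite pow0.
    + exact: measurable_funX.
    + exact: measurable_funX.
    + by rewrite divr_ge0// ltW.
    + by rewrite invr_ge0 ltW.
    + move=> w; move: (Y n w - X w) => x.
      rewrite -subr_ge0 (_ : _ - _ = ((t - x ^+ 4) ^+ 2 + x ^+ 8) / (2 * t)).
        by rewrite divr_ge0 ?addr_ge0 ?sqr_ge0 ?pow0// mulr_ge0// ltW.
      by field; rewrite gt_eqF.
  rewrite integral_cst// /= probability_setT !mule1.
  apply: (@le_trans _ _ ((t / 2)%:E + t^-1%:E * (t ^+ 2 / 2)%:E)%E).
    by rewrite leeD2l// lee_wpmul2l// lee_fin invr_ge0 ltW.
  rewrite -EFinM -EFinD lee_fin (_ : _ + _ = t)//.
  by field; rewrite gt_eqF.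
have pc2 := @pow_close2 R.
have pc4 := pow_close_double (p := 2) isT pc2.
have pc8 := pow_close_double (p := 4) isT pc4.
have v2 n : (\int[P]_w (Y n w ^+ 2)%:E = (v n)%:E)%E by have [] := vP n.
have v4 n : (\int[P]_w (Y n w ^+ 4)%:E = (3 * v n ^+ 2)%:E)%E by have [] := vP n.
have v8 n : (\int[P]_w (Y n w ^+ 8)%:E = (105 * v n ^+ 4)%:E)%E by have [] := vP n.
have [l lE vl] := cvg_integral_pow (p := 2) isT pc2 mY mX v2 YX.
have [l4 l4E vl4] := cvg_integral_pow (p := 4) isT pc4 mY mX v4 YX4.
have [l8 l8E vl8] := cvg_integral_pow (p := 8) isT pc8 mY mX v8 YX8.
have vpow j : v n ^+ j @[n --> \oo] --> l ^+ j.
  by apply: (cvg_comp v (fun x => x ^+ j) vl); exact: exprn_continuous.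
split => //; exists l.
  by rewrite -lee_fin -lE; apply: integral_ge0 => w _; rewrite lee_fin sqr_ge0.
split => //.
- have h : 3 * v n ^+ 2 @[n --> \oo] --> 3 * l ^+ 2 by apply: cvgMr; exact: vpow.
  by rewrite l4E; congr EFin; have := cvg_unique _ vl4 h; exact.
- have h : 105 * v n ^+ 4 @[n --> \oo] --> 105 * l ^+ 4 by apply: cvgMr; exact: vpow.
  by rewrite l8E; congr EFin; have := cvg_unique _ vl8 h; exact.
Qed.

(** * Limits of combinations of the noise *)

Definition noise_combination (R : realType) (Omega : Type)
    (W : set (spacetime R) -> Omega -> R) (Y : Omega -> R) : Prop :=
  exists (n : nat) (c : nat -> R) (A : nat -> set (spacetime R)),
    (forall k, noise_set (A k)) /\ Y = (fun w => \sum_(k < n) c k * W (A k) w).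

(** The closed linear span of the noise in L^2(P); it contains every Wiener
    integral, and it is a space of Gaussian variables. *)
Definition noise_limit (R : realType) (d : measure_display)
    (Omega : measurableType d) (P : probability Omega R)
    (W : set (spacetime R) -> Omega -> R) (X : Omega -> R) : Prop :=
  measurable_fun setT X /\
  exists2 Y : nat -> Omega -> R, (forall n, noise_combination W (Y n)) &
    (\int[P]_w ((Y n w - X w) ^+ 2)%:E)%E @[n --> \oo] --> 0%E.

Lemma noise_combination_lincomb (R : realType) (Omega : Type)
    (W : set (spacetime R) -> Omega -> R) (a b : R) (X Y : Omega -> R) :
  noise_combination W X -> noise_combination W Y ->
  noise_combination W (fun w => a * X w + b * Y w).
Proof.
move=> [m [c [A [hA ->]]]] [n [e [B [hB ->]]]].
exists (m + n)%N, (fun k => if (k < m)%N then a * c k else b * e (k - m)%N),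
  (fun k => if (k < m)%N then A k else B (k - m)%N); split.
  by move=> k; case: ifP.
apply/funext => w; rewrite big_split_ord/= !mulr_sumr; congr (_ + _).
  by apply: eq_bigr => i _; rewrite ltn_ord mulrA.
by apply: eq_bigr => i _; rewrite ltnNge leq_addr/= addKn mulrA.
Qed.

Section white_noise_limits.
Context (R : realType) (d : measure_display) (Omega : measurableType d)
  (P : probability Omega R) (W : set (spacetime R) -> Omega -> R)
  (hW : white_noise P W).

Lemma noise_combination_moments (Y : Omega -> R) :
  noise_combination W Y -> gaussian_moments P Y.
Proof.
move=> [n [c [A [hA ->]]]].
by apply: centered_gaussian_moments; exact: (white_noise_gaussian hW).
Qed.

Lemma noise_limit_moments (X : Omega -> R) :
  noise_limit P W X -> gaussian_moments P X.
Proof.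
move=> [mX [Y hY YX]]; apply: (gaussian_moments_L2_limit (Y := Y)) => //.
  by move=> n; exact: noise_combination_moments.
move=> n m; apply: noise_combination_moments.
have -> : (fun w => Y n w - Y m w) = (fun w => 1 * Y n w + (-1) * Y m w).
  by apply/funext => w; rewrite mul1r mulN1r.
exact: noise_combination_lincomb.
Qed.

Lemma noise_limit_wiener (g : spacetime R -> R) (X : Omega -> R) :
  wiener_integral P W g X -> noise_limit P W X.
Proof.
move=> [_ mX [m [c [A [hA _ WX]]]]]; split => //.
exists (fun n w => \sum_(k < m n) c n k * W (A n k) w) => // n.
by exists (m n), (c n), (A n); split.
Qed.

Lemma noise_limit_lincomb (a b : R) (X Y : Omega -> R) :
  noise_limit P W X -> noise_limit P W Y ->
  noise_limit P W (fun w => a * X w + b * Y w).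
Proof.
move=> [mX [U hU UX]] [mY [V hV VY]]; split.
  by apply: measurable_funD; exact: measurable_funM.
exists (fun n w => a * U n w + b * V n w).
  by move=> n; exact: noise_combination_lincomb.
have mU n : measurable_fun setT (U n) by have [] := noise_combination_moments (hU n).
have mV n : measurable_fun setT (V n) by have [] := noise_combination_moments (hV n).
have lim0 : ((2 * a ^+ 2)%:E * (\int[P]_w ((U n w - X w) ^+ 2)%:E) +
  (2 * b ^+ 2)%:E * (\int[P]_w ((V n w - Y w) ^+ 2)%:E))%E @[n --> \oo] --> 0%E.
  rewrite -[X in _ --> X]adde0; apply: cvgeD => //.
    by rewrite -[X in _ --> X](mule0 (2 * a ^+ 2)%:E); apply: cvgeZl.
  by rewrite -[X in _ --> X](mule0 (2 * b ^+ 2)%:E); apply: cvgeZl.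
apply: (squeeze_cvge _ (cvg_cst _) lim0); apply: nearW => n.
apply/andP; split; first by apply: integral_ge0 => w _; rewrite lee_fin sqr_ge0.
apply: integral_le_lincomb; do ?[by move=> *; rewrite sqr_ge0].
- apply: measurable_funX; apply: measurable_funB;
    by apply: measurable_funD; exact: measurable_funM.
- by apply: measurable_funX; exact: measurable_funB.
- by apply: measurable_funX; exact: measurable_funB.
- by rewrite mulr_ge0// sqr_ge0.
- by rewrite mulr_ge0// sqr_ge0.
- move=> w; rewrite -subr_ge0 (_ : _ - _ =
    (a * (U n w - X w) - b * (V n w - Y w)) ^+ 2) ?sqr_ge0//.
  ring.
Qed.

End white_noise_limits.

(** * The covariance of the heat process *)

Lemma heat_kernel_ge0 (R : realType) (t x : R) : 0 <= heat_kernel t x.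
Proof. by rewrite mulr_ge0 ?invr_ge0 ?sqrtr_ge0 ?expR_ge0. Qed.

Lemma heat_kernel0 (R : realType) (x : R) : heat_kernel 0 x = 0.
Proof. by rewrite /heat_kernel mulr0 sqrtr0 invr0 mul0r. Qed.

(** The product of two Gaussian densities centred at x, of variances a and b, is a
    multiple of the density of variance ab / (a + b). *)
Lemma heat_kernel_semigroup (R : realType) (a b x : R) : 0 < a -> 0 < b ->
  (\int[@lebesgue_measure R]_y (heat_kernel a (x - y) * heat_kernel b (x - y))%:E
   = ((Num.sqrt (2 * pi * (a + b)))^-1)%:E)%E.
Proof.
move=> a0 b0; have ab0 : 0 < a + b by rewrite addr_gt0.
have p0 : 0 < pi :> R := pi_gt0 R.
pose c := a * b / (a + b).
have c0 : 0 < c by rewrite divr_gt0// mulr_gt0.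
have sc0 : Num.sqrt c != 0 by rewrite gt_eqF// sqrtr_gt0.
set K := (Num.sqrt (2 * pi * (a + b)))^-1.
have E y : heat_kernel a (x - y) * heat_kernel b (x - y) = K * normal_pdf x (Num.sqrt c) y.
  rewrite normal_pdfE// /normal_fun /normal_peak sqr_sqrtr ?ltW//.
  rewrite /heat_kernel mulrACA -expRD mulrA; congr (_ * expR _); last first.
    rewrite /c; field.
    by rewrite ?gt_eqF.
  rewrite /K -!invfM -!sqrtrM; do ?[by rewrite !mulr_ge0// ltW].
  congr (Num.sqrt _)^-1; rewrite /c; field.
  by rewrite gt_eqF.
under eq_integral do rewrite E EFinM.
rewrite ge0_integralZl//.
- by rewrite integral_normal_pdf mule1.
- by apply/measurable_EFinP; exact: measurable_normal_pdf.
- by move=> y _; rewrite lee_fin normal_pdf_ge0.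
- by rewrite lee_fin invr_ge0 sqrtr_ge0.
Qed.

Lemma is_derive_sqrt_affine (R : realType) (c r : R) : 2 * r < c ->
  is_derive r (1:R) (fun r => - (Num.sqrt (c - 2 * r) / Num.sqrt (2 * pi)))
    (Num.sqrt (2 * pi * (c - 2 * r)))^-1.
Proof.
move=> rc; have p0 : 0 < pi :> R := pi_gt0 R.
have c0 : 0 < c - 2 * r by rewrite subr_gt0.
have h : is_derive r (1:R) (fun r => c - 2 * r) (- 2).
  by apply: is_derive_eq; rewrite /GRing.scale/=; ring.
have hs := @is_derive1_comp R Num.sqrt _ r _ _ (is_derive1_sqrt c0) h.
apply: is_derive_eq; rewrite /GRing.scale/=.
have -> : Num.sqrt (2 * pi * (c - 2 * r)) = Num.sqrt (2 * pi) * Num.sqrt (c - 2 * r).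
  by rewrite sqrtrM// mulr_ge0// ltW.
have s0 : Num.sqrt (c - 2 * r) != 0 by rewrite gt_eqF// sqrtr_gt0.
have s1 : Num.sqrt (2 * pi) != 0 :> R by rewrite gt_eqF// sqrtr_gt0 mulr_gt0.
by field; rewrite s0 s1.
Qed.

(** When s = t the integrand blows up at the right end point, so the fundamental
    theorem is applied on [0, s - s/(n+2)] and n tends to infinity. *)
Lemma integral_inv_sqrt (R : realType) (s t : R) : 0 <= s -> s <= t ->
  (\int[@lebesgue_measure R]_(r in `[0%R, s[) ((Num.sqrt (2 * pi * (t + s - 2 * r)))^-1)%:E
   = ((Num.sqrt (t + s) - Num.sqrt (t - s)) / Num.sqrt (2 * pi))%:E)%E.
Proof.
rewrite le_eqVlt => /predU1P[<-|s0] st.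
  by rewrite addr0 subr0 subrr mul0r set_itv_ge ?bnd_simp ?ltxx// integral_set0.
pose b n : R := s - s / n.+2%:R.
have bs n : 0 < b n < s.
  rewrite /b subr_gt0 gtrBl divr_gt0// andbT ltr_pdivrMr//.
  by rewrite ltr_pMr// ltr1n.
have bcvg : b n @[n --> \oo] --> s.
  rewrite -[X in _ --> X]subr0 -(mulr0 s); apply: cvgB; first exact: cvg_cst.
  apply: cvgMr; rewrite (cvg_shiftS (@harmonic R)); exact: cvg_harmonic.
pose f (r : R) := (Num.sqrt (2 * pi * (t + s - 2 * r)))^-1.
pose H (r : R) := - (Num.sqrt (t + s - 2 * r) / Num.sqrt (2 * pi)).
have affcont (c r : R) : (c - 2 * r') @[r' --> r] --> c - 2 * r.
  by apply: cvgB; [exact: cvg_cst|apply: cvgMr; exact: cvg_id].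
have Hcont : continuous H.
  move=> r; apply: cvgN; apply: cvgMl.
  by apply: (cvg_comp _ _ (affcont (t + s) r)); exact: sqrt_continuous.
have fcont r : r < s -> {for r, continuous f}.
  move=> rs; apply: cvgV.
    by rewrite gt_eqF// sqrtr_gt0 !mulr_gt0 ?pi_gt0//; lra.
  have aff2 : (2 * pi * (t + s - 2 * r')) @[r' --> r] --> 2 * pi * (t + s - 2 * r).
    by apply: cvgMr; exact: affcont.
  by apply: (cvg_comp _ _ aff2); exact: sqrt_continuous.
have dH r : r < s -> is_derive r (1:R) H (f r).
  by move=> rs; apply: is_derive_sqrt_affine; lra.
have fwithin n : {within `[0, b n], continuous f}.
  apply: continuous_in_subspaceT => r; rewrite inE/= in_itv/= => /andP[_ rb].
  by apply: fcont; have /andP[_ bn] := bs n; exact: le_lt_trans bn.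
have ftc n : (\int[@lebesgue_measure R]_(r in `[0%R, b n]) (f r)%:E = (H (b n) - H 0)%:E)%E.
  have /andP[b0 bn] := bs n.
  apply: continuous_FTC2 => //.
  - split.
    + by move=> r; rewrite in_itv/= => /andP[_ rb]; have [] := dH r (lt_trans rb bn).
    + by apply: cvg_at_right_filter; exact: Hcont.
    + by apply: cvg_at_left_filter; exact: Hcont.
  - move=> r; rewrite in_itv/= => /andP[_ rb].
    by rewrite derive1E; have [_ ->] := dH r (lt_trans rb bn).
have UE : `[0%R, s[%classic = \bigcup_n (`[0%R, b n]%classic : set R).
  apply/seteqP; split=> [r/=|r [n _]]; rewrite /= !in_itv/= => /andP[r0 rs].
    have [n rn] := filter_ex (cvgr_gt _ bcvg _ rs).
    by exists n => //=; rewrite in_itv/= r0 ltW.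
  by rewrite r0 (le_lt_trans rs)//; have /andP[] := bs n.
have A : (\int[@lebesgue_measure R]_(r in `[0%R, b n]) (f r)%:E)%E @[n --> \oo] -->
   (\int[@lebesgue_measure R]_(r in `[0%R, s[) (f r)%:E)%E.
  rewrite UE; apply: ge0_nondecreasing_set_cvg_integral => //.
  - move=> m n mn; apply/subsetPset => r/=; rewrite !in_itv/= => /andP[-> rb] /=.
    rewrite (le_trans rb)// /b lerD2l lerN2 ler_wpM2l ?(ltW s0)//.
    by rewrite lef_pV2 ?posrE ?ltr0n// ler_nat !ltnS.
  - by move=> n; apply/measurable_EFinP; exact: subspace_continuous_measurable_fun.
  - by move=> n r _; rewrite lee_fin invr_ge0 sqrtr_ge0.
have B : (\int[@lebesgue_measure R]_(r in `[0%R, b n]) (f r)%:E)%E @[n --> \oo] -->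
   (H s - H 0)%:E.
  under eq_fun do rewrite ftc.
  apply: cvg_EFin; first exact: nearW.
  apply: cvgB; last exact: cvg_cst.
  by apply: (cvg_comp b H bcvg); exact: Hcont.
have -> := cvg_unique _ A B => //.
rewrite /H mulr0 subr0 (_ : t + s - 2 * s = t - s); last by ring.
by congr EFin; ring.
Qed.

Lemma measurable_halfplane (R : realType) : measurable (@halfplane R).
Proof.
rewrite -[@halfplane R]setTI.
rewrite (_ : @halfplane R = fst @^-1` (`[0%R, +oo[%classic : set (measurableTypeR R))); last first.
  by apply/seteqP; split => z; rewrite /halfplane/= in_itv/= andbT.
by apply: measurable_fst.
Qed.

(** For r < s the inner integral in space is the heat kernel at time
    (s - r) + (t - r) and position 0; it remains to integrate in r. *)
Lemma heat_integrand_inner_product (R : realType) (x s t : R) : 0 <= s -> s <= t ->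
  measurable_fun (@halfplane R) (heat_integrand x s) ->
  measurable_fun (@halfplane R) (heat_integrand x t) ->
  (\int[leb2 R]_(z in @halfplane R) (heat_integrand x s z * heat_integrand x t z)%:E
   = ((Num.sqrt (t + s) - Num.sqrt (t - s)) / Num.sqrt (2 * pi))%:E)%E.
Proof.
move=> s0 st ms mt.
pose f (z : spacetime R) : \bar R := (heat_integrand x s z * heat_integrand x t z)%:E.
have hge u z : 0 <= heat_integrand x u z.
  by rewrite /heat_integrand; case: ifP => // _; exact: heat_kernel_ge0.
have f0 z : (0 <= f z)%E by rewrite lee_fin mulr_ge0.
have fE : f \_ (@halfplane R) = f.
  apply/funext => z; rewrite patchE; case: ifPn => // /negP; rewrite inE /halfplane/= => z0.
  rewrite /f /heat_integrand; case: ifP => [/andP[zz]|]; first by rewrite zz in z0.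
  by rewrite mul0r.
have mf : measurable_fun setT f.
  rewrite -fE; apply/(measurable_restrictT _ (@measurable_halfplane R)).
  by apply/measurable_EFinP; exact: measurable_funM.
rewrite integral_mkcond -/f fE fubini_tonelli1//.
rewrite -integral_inv_sqrt// [RHS]integral_mkcond.
apply: eq_integral => r _; rewrite patchE /fubini_F /f.
have [/andP[r0 rs]|rs] := boolP ((0 <= r) && (r < s)).
  rewrite mem_set/=; last by rewrite in_itv/= r0.
  rewrite (_ : t + s - 2 * r = (s - r) + (t - r)); last by ring.
  rewrite -(heat_kernel_semigroup x); [|lra..].
  apply: eq_integral => y _; rewrite /heat_integrand/= r0 (ltW rs) (le_trans (ltW rs))//.
rewrite memNset/=; last by rewrite in_itv/=; exact/negP.
apply: integral0_eq => y _.
rewrite /heat_integrand/=; case: (boolP ((0 <= r) && (r <= s))) => [/andP[r0 rs']|_]; last by rewrite mul0r.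
have -> : r = s by apply/eqP; rewrite eq_le rs'/= leNgt; move: rs; rewrite r0.
by rewrite subrr heat_kernel0 mul0r.
Qed.

(** * Moments of pairs of Gaussian variables *)

Section moment_calculus.
Context (R : realType) (d : measure_display) (T : measurableType d)
  (P : probability T R).
Implicit Types f g X Y : T -> R.

Lemma integrable_lincomb (a b : R) f g :
  P.-integrable setT (EFin \o f) -> P.-integrable setT (EFin \o g) ->
  P.-integrable setT (EFin \o (fun w => a * f w + b * g w)).
Proof.
move=> fi gi.
have -> : EFin \o (fun w => a * f w + b * g w) =
    (fun w => a%:E * (EFin \o f) w)%E \+ (fun w => b%:E * (EFin \o g) w)%E.
  by apply/funext => w /=; rewrite -!EFinM.
by apply: integrableD => //; exact: integrableZl.
Qed.

Lemma Rintegral_lincomb (a b : R) f g :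
  P.-integrable setT (EFin \o f) -> P.-integrable setT (EFin \o g) ->
  (\int[P]_w (a * f w + b * g w) = a * \int[P]_w f w + b * \int[P]_w g w)%R.
Proof.
move=> fi gi.
have Z (c : R) h : P.-integrable setT (EFin \o h) -> P.-integrable setT (EFin \o (fun w => c * h w)).
  by move=> hi; exact: (integrableZl _ c hi).
by rewrite RintegralD// ?RintegralZl//; exact: Z.
Qed.

Lemma Rintegral_sum n (f : nat -> T -> R) :
  (forall i, P.-integrable setT (EFin \o f i)) ->
  (\int[P]_w (\sum_(i < n) f i w) = \sum_(i < n) \int[P]_w f i w)%R
  /\ P.-integrable setT (EFin \o (fun w => \sum_(i < n) f i w)).
Proof.
move=> fi; elim: n => [|n [IHe IHi]].
  have -> : (fun w => \sum_(i < 0) f i w) = cst 0.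
    by apply/funext => w; rewrite big_ord0.
  by rewrite big_ord0; split; [rewrite Rintegral_cst// mul0r|exact: integrable0].
have E : (fun w => \sum_(i < n.+1) f i w) =
    (fun w => 1 * (\sum_(i < n) f i w) + 1 * f n w).
  by apply/funext => w; rewrite big_ord_recr/= !mul1r.
rewrite E; split; last exact: integrable_lincomb.
by rewrite Rintegral_lincomb// big_ord_recr/= IHe !mul1r.
Qed.

Lemma integral_Rintegral f : P.-integrable setT (EFin \o f) ->
  (\int[P]_w (f w)%:E = (\int[P]_w f w)%R%:E)%E.
Proof. by move=> fi; rewrite /Rintegral fineK//; exact: integrable_fin_num. Qed.

Definition moments8 X := measurable_fun setT X /\ P.-integrable setT (EFin \o (fun w => X w ^+ 8)).

(** If m is the larger of |X| and |Y|, then |X^i Y^j| <= m^(i+j) <= 1 + m^8. *)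
Lemma integrable_monomial X Y i j : moments8 X -> moments8 Y -> (i + j <= 8)%N ->
  P.-integrable setT (EFin \o (fun w => X w ^+ i * Y w ^+ j)).
Proof.
move=> [mX iX] [mY iY] ij.
have pow8 (x : R) : 0 <= x ^+ 8 by rewrite exprn_even_ge0.
have i1 : P.-integrable setT (EFin \o (fun w : T => (1 : R))).
  exact: finite_measure_integrable_cst.
have iB := integrable_lincomb 1 1 i1 (integrable_lincomb 1 1 iX iY).
apply: le_integrable iB => //.
  by apply/measurable_EFinP; apply: measurable_funM; exact: measurable_funX.
move=> w _ /=; rewrite lee_fin !mul1r.
rewrite [leRHS]ger0_norm; last by rewrite !addr_ge0.
rewrite normrM !normrX.
have -> : X w ^+ 8 = `|X w| ^+ 8 by rewrite -normrX ger0_norm.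
have -> : Y w ^+ 8 = `|Y w| ^+ 8 by rewrite -normrX ger0_norm.
move: `|X w| `|Y w| (normr_ge0 (X w)) (normr_ge0 (Y w)) => x y x0 y0.
have max_le (m : R) : 0 <= m -> m ^+ (i + j) <= 1 + m ^+ 8.
  move=> m0; have [m1|m1] := leP m 1.
    by apply: (@le_trans _ _ 1); [exact: exprn_ile1|rewrite lerDl exprn_ge0].
  by apply: (@le_trans _ _ (m ^+ 8)); [rewrite ler_weXn2l// ltW|rewrite lerDr].
have [xy|yx] := leP x y.
  apply: (@le_trans _ _ (y ^+ (i + j))).
    by rewrite exprD ler_wpM2r ?exprn_ge0// lerXn2r.
  apply: le_trans (max_le _ y0) _.
  by rewrite lerD2l lerDr exprn_ge0.
apply: (@le_trans _ _ (x ^+ (i + j))).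
  by rewrite exprD ler_wpM2l ?exprn_ge0// lerXn2r// ltW.
apply: le_trans (max_le _ x0) _.
by rewrite lerD2l lerDl exprn_ge0.
Qed.

Lemma gaussian_moments_real X : gaussian_moments P X ->
  moments8 X /\ (\int[P]_w (X w ^+ 4) = 3 * (\int[P]_w (X w ^+ 2)) ^+ 2 /\
  \int[P]_w (X w ^+ 8) = 105 * (\int[P]_w (X w ^+ 2)) ^+ 4)%R.
Proof.
move=> [mX [v v0 [v2 v4 v8]]]; split; last by rewrite /Rintegral v2 v4 v8.
split => //; apply/integrableP; split.
  by apply/measurable_EFinP; exact: measurable_funX.
under eq_integral do rewrite /= ger0_norm ?exprn_even_ge0//.
by rewrite v8 ltry.
Qed.

Lemma Rintegral_sqr_lincomb X Y (A B r : R) (a b : R) : moments8 X -> moments8 Y ->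
  (\int[P]_w (X w ^+ 2) = A)%R -> (\int[P]_w (Y w ^+ 2) = B)%R ->
  (\int[P]_w (X w * Y w) = r)%R ->
  (\int[P]_w ((a * X w + b * Y w) ^+ 2) = a ^+ 2 * A + 2 * a * b * r + b ^+ 2 * B)%R.
Proof.
move=> mX mY EX EY EXY.
have iX : P.-integrable setT (EFin \o (fun w => X w ^+ 2)).
  rewrite (_ : (fun w => X w ^+ 2) = (fun w => X w ^+ 2 * Y w ^+ 0)); first exact: integrable_monomial.
  by apply/funext => w; rewrite mulr1.
have iY : P.-integrable setT (EFin \o (fun w => Y w ^+ 2)).
  rewrite (_ : (fun w => Y w ^+ 2) = (fun w => X w ^+ 0 * Y w ^+ 2)); first exact: integrable_monomial.
  by apply/funext => w; rewrite mul1r.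
have iXY : P.-integrable setT (EFin \o (fun w => X w * Y w)).
  exact: (@integrable_monomial X Y 1 1).
rewrite (@eq_Rintegral _ _ _ _ _ (fun w => a ^+ 2 * (X w ^+ 2) + 1 * (2 * a * b * (X w * Y w) + b ^+ 2 * (Y w ^+ 2)))); last first.
  by move=> w _; ring.
rewrite Rintegral_lincomb// ?Rintegral_lincomb//; last exact: integrable_lincomb.
by rewrite EX EY EXY; ring.
Qed.

(** The Cauchy-Schwarz inequality, from nonnegativity of the quadratic form
    (a, b) |-> E[(aX + bY)^2]. *)
Lemma sqr_covariance_le X Y (A B r : R) : moments8 X -> moments8 Y ->
  (\int[P]_w (X w ^+ 2) = A)%R -> (\int[P]_w (Y w ^+ 2) = B)%R ->
  (\int[P]_w (X w * Y w) = r)%R -> r ^+ 2 <= A * B.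
Proof.
move=> mX mY EX EY EXY.
have v a b : 0 <= a ^+ 2 * A + 2 * a * b * r + b ^+ 2 * B.
  rewrite -(Rintegral_sqr_lincomb a b mX mY EX EY EXY).
  by apply: Rintegral_ge0 => w _; exact: sqr_ge0.
have B0 : 0 <= B by have := v 0 1; rewrite expr0n/= !(mul0r, mulr0) expr1n mul1r !add0r.
have [B0'|B0'] := eqVneq B 0.
  have A0 : 0 <= A by have := v 1 0; rewrite expr0n/= !(mul0r, mulr0) expr1n mul1r !addr0.
  have : 0 <= - ((A + 2) * r ^+ 2).
    by have := v r (- (A + 1)); rewrite B0'; congr (0 <= _); ring.
  by rewrite oppr_ge0 pmulr_rle0 ?ltr_wpDl// B0' mulr0.
have Bgt : 0 < B by rewrite lt_neqAle eq_sym B0'.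
have : 0 <= B * (A * B - r ^+ 2) by have := v B (- r); congr (0 <= _); ring.
by rewrite pmulr_rge0// subr_ge0.
Qed.

(** Polarization.  The polynomial X^4 Y^4 is a linear combination of eighth powers
    of eight linear forms aX + bY, whose means are known from their variances. *)
Lemma Rintegral_pow4_pow4 X Y (A B r : R) :
  (forall a b, gaussian_moments P (fun w => a * X w + b * Y w)) ->
  moments8 X -> moments8 Y ->
  (\int[P]_w (X w ^+ 2) = A)%R -> (\int[P]_w (Y w ^+ 2) = B)%R ->
  (\int[P]_w (X w * Y w) = r)%R ->
  (\int[P]_w (X w ^+ 4 * Y w ^+ 4) =
    9 * A ^+ 2 * B ^+ 2 + 72 * A * B * r ^+ 2 + 24 * r ^+ 4)%R.
Proof.
move=> gXY mX mY EX EY EXY.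
have v2 a b := Rintegral_sqr_lincomb a b mX mY EX EY EXY.
pose Z a b w := (a * X w + b * Y w) ^+ 8.
have iZ a b : P.-integrable setT (EFin \o Z a b).
  by have [[_ ]] := gaussian_moments_real (gXY a b).
have EZ a b : (\int[P]_w Z a b w = 105 * (a ^+ 2 * A + 2 * a * b * r + b ^+ 2 * B) ^+ 4)%R.
  by have [_ [_ ->]] := gaussian_moments_real (gXY a b); rewrite v2.
(* in X ^+ 4 * Y ^+ 4 = (68 S1 + 378 S2 - S3 - S4) / 5040, S1, S3 and S4
   cancel the odd powers, and the weights cancel X ^+ 6 * Y ^+ 2,
   X ^+ 2 * Y ^+ 6, X ^+ 8 and Y ^+ 8 *)
pose S1 w := 1 * Z 1 1 w + 1 * Z 1 (-1) w.
pose S2 w := 1 * Z 1 0 w + 1 * Z 0 1 w.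
pose S3 w := 1 * Z 1 2 w + 1 * Z 1 (-2) w.
pose S4 w := 1 * Z 2 1 w + 1 * Z 2 (-1) w.
pose S12 w := (68 / 5040) * S1 w + (378 / 5040) * S2 w.
pose S34 w := (- (1 / 5040)) * S3 w + (- (1 / 5040)) * S4 w.
rewrite (@eq_Rintegral _ _ _ _ _ (fun w => 1 * S12 w + 1 * S34 w)); last first.
  by move=> w _; rewrite /S12 /S34 /S1 /S2 /S3 /S4 /Z; field.
have i1 : P.-integrable setT (EFin \o S1) by exact: integrable_lincomb.
have i2 : P.-integrable setT (EFin \o S2) by exact: integrable_lincomb.
have i3 : P.-integrable setT (EFin \o S3) by exact: integrable_lincomb.
have i4 : P.-integrable setT (EFin \o S4) by exact: integrable_lincomb.
have i12 : P.-integrable setT (EFin \o S12) by exact: integrable_lincomb.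
have i34 : P.-integrable setT (EFin \o S34) by exact: integrable_lincomb.
rewrite Rintegral_lincomb// /S12 /S34 !Rintegral_lincomb//.

by rewrite !EZ; field.
Qed.

End moment_calculus.

(** * The variance of a sum of fourth powers *)

Section quartic_variance.
Context (R : realType) (d : measure_display) (T : measurableType d)
  (P : probability T R).

Lemma quartic_covariance (X Y : T -> R) (A B r : R) :
  (forall a b, gaussian_moments P (fun w => a * X w + b * Y w)) ->
  (\int[P]_w (X w ^+ 2) = A)%R -> (\int[P]_w (Y w ^+ 2) = B)%R ->
  (\int[P]_w (X w * Y w) = r)%R ->
  P.-integrable setT (EFin \o (fun w =>
    (X w ^+ 4 - 3 * A ^+ 2) * (Y w ^+ 4 - 3 * B ^+ 2))) /\
  (\int[P]_w ((X w ^+ 4 - 3 * A ^+ 2) * (Y w ^+ 4 - 3 * B ^+ 2)) =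
    72 * A * B * r ^+ 2 + 24 * r ^+ 4)%R.
Proof.
move=> gXY EX EY EXY.
have gX : gaussian_moments P X.
  rewrite (_ : X = (fun w => 1 * X w + 0 * Y w)); first exact: gXY.
  by apply/funext => w; rewrite mul1r mul0r addr0.
have gY : gaussian_moments P Y.
  rewrite (_ : Y = (fun w => 0 * X w + 1 * Y w)); first exact: gXY.
  by apply/funext => w; rewrite mul1r mul0r add0r.
have [mX [EX4 _]] := gaussian_moments_real gX.
have [mY [EY4 _]] := gaussian_moments_real gY.
have i4 : P.-integrable setT (EFin \o (fun w => X w ^+ 4 * Y w ^+ 4)).
  exact: integrable_monomial.
have iX : P.-integrable setT (EFin \o (fun w => X w ^+ 4)).
  rewrite (_ : (fun w => X w ^+ 4) = (fun w => X w ^+ 4 * Y w ^+ 0)); first exact: integrable_monomial.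
  by apply/funext => w; rewrite mulr1.
have iY : P.-integrable setT (EFin \o (fun w => Y w ^+ 4)).
  rewrite (_ : (fun w => Y w ^+ 4) = (fun w => X w ^+ 0 * Y w ^+ 4)); first exact: integrable_monomial.
  by apply/funext => w; rewrite mul1r.
have i1 : P.-integrable setT (EFin \o (fun w : T => (1 : R))).
  exact: finite_measure_integrable_cst.
have -> : (fun w => (X w ^+ 4 - 3 * A ^+ 2) * (Y w ^+ 4 - 3 * B ^+ 2)) =
  (fun w => 1 * (1 * (X w ^+ 4 * Y w ^+ 4) + (9 * A ^+ 2 * B ^+ 2) * 1) +
    1 * ((- (3 * B ^+ 2)) * X w ^+ 4 + (- (3 * A ^+ 2)) * Y w ^+ 4)).
  by apply/funext => w; ring.
have j1 := integrable_lincomb 1 (9 * A ^+ 2 * B ^+ 2) i4 i1.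
have j2 := integrable_lincomb (- (3 * B ^+ 2)) (- (3 * A ^+ 2)) iX iY.
split; first exact: integrable_lincomb.
rewrite Rintegral_lincomb// !Rintegral_lincomb//.
rewrite (Rintegral_pow4_pow4 gXY mX mY EX EY EXY) EX4 EY4 EX EY.
rewrite Rintegral_cst//= probability_setT/=; ring.
Qed.

Lemma quartic_sum_variance (n : nat) (X : nat -> T -> R) (A : nat -> R)
    (r : nat -> nat -> R) :
  (forall i j a b, gaussian_moments P (fun w => a * X i w + b * X j w)) ->
  (forall i, \int[P]_w (X i w ^+ 2) = A i)%R ->
  (forall i j, \int[P]_w (X i w * X j w) = r i j)%R ->
  P.-integrable setT (EFin \o (fun w => (\sum_(i < n) (X i w ^+ 4 - 3 * A i ^+ 2)) ^+ 2)) /\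
  (\int[P]_w ((\sum_(i < n) (X i w ^+ 4 - 3 * A i ^+ 2)) ^+ 2) =
    \sum_(i < n) \sum_(j < n) (72 * A i * A j * r i j ^+ 2 + 24 * r i j ^+ 4))%R.
Proof.
move=> gX EX EXX.
have -> : (fun w => (\sum_(i < n) (X i w ^+ 4 - 3 * A i ^+ 2)) ^+ 2) =
  (fun w => \sum_(i < n) \sum_(j < n)
     (X i w ^+ 4 - 3 * A i ^+ 2) * (X j w ^+ 4 - 3 * A j ^+ 2)).
  apply/funext => w; rewrite expr2 mulr_suml; apply: eq_bigr => i _.
  by rewrite mulr_sumr.
have c i j := quartic_covariance (gX i j) (EX i) (EX j) (EXX i j).
have s i := @Rintegral_sum _ _ _ P n
  (fun j w => (X i w ^+ 4 - 3 * A i ^+ 2) * (X j w ^+ 4 - 3 * A j ^+ 2)) (fun j => (c i j).1).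
have [-> si] := @Rintegral_sum _ _ _ P n
  (fun i w => \sum_(j < n) (X i w ^+ 4 - 3 * A i ^+ 2) * (X j w ^+ 4 - 3 * A j ^+ 2))
  (fun i => (s i).2).
split => //; apply: eq_bigr => i _; rewrite (s i).1; apply: eq_bigr => j _.
by rewrite (c i j).2.
Qed.

(** Since r^2 <= A_i A_j, each term is at most 96 A_i A_j r^2, and two of the
    factors, A_j and one |r|, are bounded by M; the remaining factor |r| is summed over j. *)
Lemma quartic_variance_le (n : nat) (A : nat -> R) (r : nat -> nat -> R) (M : R) :
  (forall i, (i < n)%N -> 0 <= A i <= M) ->
  (forall i j, r i j ^+ 2 <= A i * A j) ->
  (forall i, (i < n)%N -> \sum_(j < n) `|r i j| <= 2 * A i) ->
  \sum_(i < n) \sum_(j < n) (72 * A i * A j * r i j ^+ 2 + 24 * r i j ^+ 4)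
   <= 192 * M ^+ 2 * \sum_(i < n) A i ^+ 2.
Proof.
move=> AM rA rs; rewrite mulr_sumr; apply: ler_sum => i _.
have /andP[A0 AiM] := AM i (ltn_ord i).
have M0 : 0 <= M by exact: le_trans AiM.
apply: (@le_trans _ _ (\sum_(j < n) 96 * A i * M ^+ 2 * `|r i j|)).
  apply: ler_sum => j _.
  have /andP[B0 AjM] := AM j (ltn_ord j).
  have rAB := rA i j.
  have rM : `|r i j| <= M.
    rewrite -(ger0_norm M0) -ler_sqr ?nnegrE// real_normK ?num_real//.
    rewrite [X in _ <= X](_ : _ = M ^+ 2); last by rewrite ger0_norm.
    by apply: le_trans rAB _; rewrite expr2 ler_pM.
  have r2 : r i j ^+ 2 <= M * `|r i j|.
    by rewrite -real_normK ?num_real// expr2 ler_wpM2r.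
  have h1 : r i j ^+ 4 <= A i * A j * r i j ^+ 2.
    by rewrite (_ : r i j ^+ 4 = r i j ^+ 2 * r i j ^+ 2) ?ler_wpM2r ?sqr_ge0// -exprD.
  have h2 : A i * A j * r i j ^+ 2 <= A i * M * (M * `|r i j|).
    apply: ler_pM => //; first exact: mulr_ge0.
      exact: sqr_ge0.
    exact: ler_wpM2l.
  lra.
rewrite -mulr_sumr.
have := rs i (ltn_ord i); move: (\sum_(j < n) _) => S SA.
have : 96 * A i * M ^+ 2 * S <= 96 * A i * M ^+ 2 * (2 * A i).
  by rewrite ler_wpM2l// mulr_ge0 ?sqr_ge0// mulr_ge0.
lra.
Qed.

End quartic_variance.

(** * Square-root inequalities for the covariance *)

Section sqrt_inequalities.
Context (R : realType).
Implicit Types a b c e u h k s t : R.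

(** The covariance E[F(s) F(t)], see [heat_process_cov]. *)
Definition heat_cov s t : R :=
  (Num.sqrt (s + t) - Num.sqrt `|t - s|) / Num.sqrt (2 * pi).

(** The covariance of the increments of F over [a, b] and [c, e]. *)
Definition heat_incr_cov a b c e : R :=
  heat_cov b e - heat_cov b c - heat_cov a e + heat_cov a c.

(** Concavity of the square root: its increment over a step of length k decreases
    when the starting point moves from u to u + h. *)
Lemma sqrt_four_point u h k : 0 <= u -> 0 <= h -> 0 <= k ->
  Num.sqrt (u + h + k) + Num.sqrt u <= Num.sqrt (u + h) + Num.sqrt (u + k).
Proof.
move=> u0 h0 k0.
have uh0 : 0 <= u + h by rewrite addr_ge0.
have uk0 : 0 <= u + k by rewrite addr_ge0.
have uhk0 : 0 <= u + h + k by rewrite addr_ge0.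
rewrite -ler_sqr ?nnegrE ?addr_ge0 ?sqrtr_ge0//.
rewrite !sqrrD !sqr_sqrtr// -!sqrtrM//.
have : Num.sqrt ((u + h + k) * u) <= Num.sqrt ((u + h) * (u + k)).
  rewrite ler_wsqrtr//; have := mulr_ge0 h0 k0; nra.
lra.
Qed.

Lemma sqrt2pi_gt0 : 0 < Num.sqrt (2 * pi) :> R.
Proof. by rewrite sqrtr_gt0 mulr_gt0 ?pi_gt0. Qed.

Lemma heat_covC s t : heat_cov s t = heat_cov t s.
Proof. by rewrite /heat_cov (addrC s t) (distrC s t). Qed.

Lemma heat_cov0 s : 0 <= s -> heat_cov s 0 = 0.
Proof. by move=> s0; rewrite /heat_cov addr0 sub0r normrN ger0_norm// subrr mul0r. Qed.

(** Both square roots in [heat_cov] contribute a nonpositive amount, by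
    [sqrt_four_point] at u = a + c and at u = c - b. *)
Lemma heat_incr_cov_le0 a b c e : 0 <= a -> a <= b -> b <= c -> c <= e ->
  heat_incr_cov a b c e <= 0.
Proof.
move=> a0 ab bc ce.
have s0 := sqrt2pi_gt0.
rewrite /heat_incr_cov /heat_cov.
rewrite -!mulrBl -mulrDl pmulr_lle0 ?invr_gt0//.
rewrite !ger0_norm ?subr_ge0//; try lra.
have := @sqrt_four_point (a + c) (b - a) (e - c).
have := @sqrt_four_point (c - b) (b - a) (e - c).
rewrite (_ : c - b + (b - a) + (e - c) = e - a); last by ring.
rewrite (_ : c - b + (b - a) = c - a); last by ring.
rewrite (_ : c - b + (e - c) = e - b); last by ring.
rewrite (_ : a + c + (b - a) + (e - c) = b + e); last by ring.
rewrite (_ : a + c + (b - a) = b + c); last by ring.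
rewrite (_ : a + c + (e - c) = a + e); last by ring.
move=> /(_ ltac:(lra) ltac:(lra) ltac:(lra)) h1 /(_ ltac:(lra) ltac:(lra) ltac:(lra)) h2.
lra.
Qed.

Lemma heat_incr_covC a b c e : heat_incr_cov a b c e = heat_incr_cov c e a b.
Proof.
rewrite /heat_incr_cov (heat_covC b e) (heat_covC b c) (heat_covC a e) (heat_covC a c).
ring.
Qed.

Lemma heat_cov_nondecreasing a b t : 0 <= a -> a <= b -> b <= t ->
  heat_cov a t <= heat_cov b t.
Proof.
move=> a0 ab bt; rewrite /heat_cov ler_wpM2r ?invr_ge0 ?sqrtr_ge0//.
rewrite !ger0_norm; [|lra|lra].
by apply: lerB; rewrite ler_wsqrtr//; lra.
Qed.

(** The sum sqrt(2a) + sqrt(2b) - 2 sqrt(a+b) is nonpositive by concavity, and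
    at least sqrt(2a) - sqrt(2b) by monotonicity. *)
Lemma heat_incr_var a b : 0 <= a -> a <= b ->
  Num.sqrt (2 / pi) * Num.sqrt (b - a) -
    (Num.sqrt (2 * b) - Num.sqrt (2 * a)) / Num.sqrt (2 * pi) <=
  heat_incr_cov a b a b <= Num.sqrt (2 / pi) * Num.sqrt (b - a).
Proof.
move=> a0 ab.
set q := Num.sqrt (2 / pi) * _; set err := (_ - _) / _.
have s0 := sqrt2pi_gt0; have p0 : 0 < pi :> R := pi_gt0 R.
have b0 : 0 <= b by exact: le_trans ab.
have qE : q = 2 * Num.sqrt (b - a) / Num.sqrt (2 * pi).
  have half (c : R) : 0 < c -> 2 / c = 2 ^+ 2 / (2 * c).
    by move=> c0; field; rewrite gt_eqF.
  rewrite /q half//.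
  rewrite sqrtrM ?sqr_ge0// sqrtr_sqr ger0_norm// sqrtrV; last by rewrite mulr_ge0// ltW.
  by rewrite mulrAC.
have vE : heat_incr_cov a b a b = (Num.sqrt (2 * b) + Num.sqrt (2 * a) -
    2 * Num.sqrt (a + b) + 2 * Num.sqrt (b - a)) / Num.sqrt (2 * pi).
  rewrite /heat_incr_cov /heat_cov !subrr normr0 sqrtr0 (addrC b a).
  rewrite (distrC a b) (ger0_norm (_ : 0 <= b - a)); last by lra.
  have -> : b + b = 2 * b by ring.
  have -> : a + a = 2 * a by ring.
  by move: (Num.sqrt (2 * pi)) => c; ring.
rewrite vE qE /err -mulrBl !ler_pM2r ?invr_gt0//.
have h1 : Num.sqrt (a + b) <= Num.sqrt (2 * b) by rewrite ler_wsqrtr//; lra.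
have h2 : Num.sqrt (2 * b) + Num.sqrt (2 * a) <= 2 * Num.sqrt (a + b).
  rewrite -ler_sqr ?nnegrE ?addr_ge0 ?mulr_ge0 ?sqrtr_ge0//.
  rewrite sqrrD exprMn !sqr_sqrtr ?mulr_ge0//; last by lra.
  rewrite -sqrtrM ?mulr_ge0//.
  have : Num.sqrt (2 * b * (2 * a)) <= a + b.
    rewrite -[leRHS]ger0_norm; last by lra.
    rewrite -sqrtr_sqr ler_wsqrtr//.
    have := sqr_ge0 (a - b); nra.
  lra.
by apply/andP; split; lra.
Qed.

End sqrt_inequalities.

(** * Partitions, quartic variation and covariances of increments *)

Section partitions.
Context (R : realType) (p : time_partition R).

Lemma knot_nondecreasing m n : (m <= n)%N -> p m <= p n.
Proof.
by apply: (homo_leq (@lexx _ _) (@le_trans _ R)) => k; exact/ltW/knot_lt.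
Qed.

Lemma knot_ge0 n : 0 <= p n.
Proof. by rewrite -(knot0 p) knot_nondecreasing. Qed.

Lemma knot_countP t : 0 <= t ->
  p (knot_count p t) <= t /\ forall m, p m <= t -> (m <= knot_count p t)%N.
Proof.
move=> t0; rewrite /knot_count.
have [n0 hn0] : exists n, t < p n.
  have /cvgryPgt/(_ t) h := knot_cvg p.
  exact: filter_ex h.
have b m : p m <= t -> (m <= n0)%N.
  move=> pm; rewrite leqNgt; apply/negP => /ltnW/knot_nondecreasing.
  by rewrite leNgt (le_lt_trans pm).
have ex : exists n, p n <= t by exists 0%N; rewrite knot0.
have := ex_maxnP ex b; case=> N pN maxN.
by case: xgetP => [n -> []//|/(_ N)]; case.
Qed.

Lemma knot_count_gt t : 0 <= t -> t < p (knot_count p t).+1.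
Proof.
move=> t0; rewrite ltNge; apply/negP => h.
by have := (knot_countP t0).2 _ h; rewrite ltnn.
Qed.

Lemma knot_step_lt (delta : R) j : (mesh p < delta%:E)%E -> p j.+1 - p j < delta.
Proof.
move=> h; rewrite -lte_fin; apply: le_lt_trans h.
by apply: ereal_sup_ubound; exists j.
Qed.

Lemma knot_telescope (f : R -> R) n :
  \sum_(i < n) (f (p i.+1) - f (p i)) = f (p n) - f (p 0%N).
Proof.
elim: n => [|n IH]; first by rewrite big_ord0 subrr.
by rewrite big_ord_recr/= IH; ring.
Qed.

Lemma quartic_variationE (Omega : Type) (F : R -> Omega -> R) t w :
  quartic_variation F p t w =
  \sum_(i < knot_count p t) (F (p i.+1) w - F (p i) w) ^+ 4.
Proof.
rewrite /quartic_variation big_add1/= big_mkord; apply: eq_bigr => i _.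
by rewrite -normrX ger0_norm// exprn_even_ge0.
Qed.

Lemma quartic_variation_nondecreasing (Omega : Type) (F : R -> Omega -> R) s t w :
  0 <= s -> s <= t -> quartic_variation F p s w <= quartic_variation F p t w.
Proof.
move=> s0 st; have t0 := le_trans s0 st.
have N : (knot_count p s <= knot_count p t)%N.
  by apply: (knot_countP t0).2; exact: le_trans (knot_countP s0).1 st.
rewrite !quartic_variationE -!(big_mkord xpredT (fun i => (F (p i.+1) w - F (p i) w) ^+ 4)).
rewrite [leRHS](@big_cat_nat _ _ _ (knot_count p s))//= lerDl; apply: sumr_ge0 => i _.
by rewrite exprn_even_ge0.
Qed.

End partitions.

Section increments.
Context (R : realType) (p : time_partition R).

Definition knot_var i : R := heat_incr_cov (p i) (p i.+1) (p i) (p i.+1).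
Definition knot_cov i j : R := heat_incr_cov (p i) (p i.+1) (p j) (p j.+1).

Lemma knot_cov_le0 i j : i != j -> knot_cov i j <= 0.
Proof.
rewrite neq_ltn => /orP[] ij; [|rewrite /knot_cov heat_incr_covC];
  by apply: heat_incr_cov_le0; rewrite ?knot_ge0// knot_nondecreasing.
Qed.

(** The sum telescopes to the covariance of the i-th increment with F(t_n). *)
Lemma sum_knot_cov_ge0 n i : (i < n)%N -> 0 <= \sum_(j < n) knot_cov i j.
Proof.
move=> ni.
have := knot_telescope p (fun t => heat_cov (p i.+1) t - heat_cov (p i) t) n.
rewrite knot0 !heat_cov0 ?knot_ge0// !subr0 => E.
have -> : \sum_(j < n) knot_cov i j = heat_cov (p i.+1) (p n) - heat_cov (p i) (p n).
  by rewrite -E; apply: eq_bigr => j _; rewrite /knot_cov /heat_incr_cov; ring.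
by rewrite subr_ge0 heat_cov_nondecreasing ?knot_ge0// knot_nondecreasing.
Qed.

(** Only the diagonal term is positive, so the sum of the absolute values is twice
    the diagonal term minus the sum of all the terms. *)
Lemma sum_norm_knot_cov n i : (i < n)%N -> 0 <= knot_var i ->
  \sum_(j < n) `|knot_cov i j| <= 2 * knot_var i.
Proof.
move=> ni v0; have := sum_knot_cov_ge0 ni.
rewrite (bigD1 (Ordinal ni))//= [X in _ -> X <= _](bigD1 (Ordinal ni))//=.
rewrite -/(knot_var i) ger0_norm//.
have -> : \sum_(j < n | j != Ordinal ni) `|knot_cov i j| =
    - \sum_(j < n | j != Ordinal ni) knot_cov i j.
  rewrite -sumrN; apply: eq_bigr => j ij; rewrite ler0_norm//.
  by apply: knot_cov_le0; rewrite eq_sym; exact: ij.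
rewrite -/(knot_cov i i) (_ : knot_cov i i = knot_var i)//; lra.
Qed.

Let q i : R := Num.sqrt (2 / pi) * Num.sqrt (p i.+1 - p i).

Lemma sqrt_2Vpi_le1 : Num.sqrt (2 / pi) <= 1 :> R.
Proof.
have p0 : 0 < pi :> R := pi_gt0 R.
by rewrite -[leRHS]sqrtr1 ler_wsqrtr// ler_pdivrMr// mul1r pi_ge2.
Qed.

Lemma knot_var_le_sqrt i : knot_var i <= Num.sqrt (p i.+1 - p i).
Proof.
have le := knot_nondecreasing p (leqnSn i).
have /andP[_] := heat_incr_var (knot_ge0 p i) le.
move=> /le_trans; apply; rewrite -[leRHS]mul1r ler_wpM2r//.
exact: sqrt_2Vpi_le1.
Qed.

(** Let A_i be the variance of the i-th increment and q_i >= 0 be such that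
    q_i^2 = (2/pi)(t_(i+1) - t_i).  Then 3 A_i^2 - (6/pi)(t_(i+1) - t_i) equals
    3 (A_i - q_i)(A_i + q_i).  The last factor is at most 2 sqrt(mesh), and
    q_i - A_i is at most a difference that telescopes, by [heat_incr_var]. *)
Lemma knot_var_bias n (delta : R) : (forall i, 0 <= knot_var i) ->
  (mesh p < delta%:E)%E ->
  `|\sum_(i < n) 3 * knot_var i ^+ 2 - 6 / pi * p n| <=
    6 * Num.sqrt delta * Num.sqrt (p n).
Proof.
move=> v0 md; have p0 : 0 < pi :> R := pi_gt0 R.
have -> : 6 / pi * p n = \sum_(i < n) (6 / pi * p i.+1 - 6 / pi * p i).
  by rewrite (knot_telescope p (fun t => 6 / pi * t)) knot0 mulr0 subr0.
rewrite -sumrB; apply: le_trans (ler_norm_sum _ _ _) _.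
pose e (t : R) := Num.sqrt (2 * t) / Num.sqrt (2 * pi).
apply: (@le_trans _ _ (\sum_(i < n) 6 * Num.sqrt delta * (e (p i.+1) - e (p i)))).
  apply: ler_sum => i _.
  have le := knot_nondecreasing p (leqnSn i).
  have /andP[lo up] := heat_incr_var (knot_ge0 p i) le.
  rewrite -/(knot_var i) -/(q i) in lo up.
  have {}lo : q i - (e (p i.+1) - e (p i)) <= knot_var i.
    by apply: le_trans lo; rewrite /e -mulrBl.
  have q0 : 0 <= q i by rewrite mulr_ge0 ?sqrtr_ge0.
  have qd : q i <= Num.sqrt delta.
    rewrite -[leRHS]mul1r; apply: ler_pM; rewrite ?sqrtr_ge0 ?sqrt_2Vpi_le1//.
    by rewrite ler_wsqrtr// ltW// knot_step_lt.
  have q2 : 6 / pi * p i.+1 - 6 / pi * p i = 3 * q i ^+ 2.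
    rewrite /q exprMn !sqr_sqrtr ?subr_ge0// ?divr_ge0// ?ltW//.
    by move: (pi : R) p0 => c c0; field; rewrite gt_eqF.
  rewrite q2 -mulrBr normrM (ger0_norm (_ : 0 <= 3))// subr_sqr normrM.
  move: (e (p i.+1)) (e (p i)) lo => u v lo.
  have vi0 := v0 i.
  have s0 : 0 <= knot_var i + q i by exact: addr_ge0.
  rewrite ler0_norm ?subr_le0// (ger0_norm s0).
  have : (q i - knot_var i) * (knot_var i + q i) <= (u - v) * (2 * Num.sqrt delta).
    by apply: ler_pM; lra.
  lra.
rewrite -mulr_sumr knot_telescope knot0 /e mulr0 sqrtr0 mul0r subr0.
rewrite ler_wpM2l ?mulr_ge0 ?sqrtr_ge0//.
rewrite ler_pdivrMr ?sqrt2pi_gt0// -sqrtrM ?knot_ge0// ler_wsqrtr//.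
rewrite mulrC ler_wpM2l ?knot_ge0//.
by rewrite ler_peMr// (le_trans _ (pi_ge2 R))// ler1n.
Qed.

End increments.

(** * Convergence in L^2 at a fixed time *)

(** The integral of a nonnegative function is a supremum over the simple functions
    below it, hence monotone on all nonnegative functions.  This is what allows a
    supremum over uncountably many times to be bounded under the integral. *)
Lemma nneg_le_integral (R : realType) (d : measure_display)
    (T : measurableType d) (mu : {measure set T -> \bar R}) (f g : T -> \bar R) :
  (forall x, 0 <= f x)%E -> (forall x, f x <= g x)%E ->
  (\int[mu]_x f x <= \int[mu]_x g x)%E.
Proof.
move=> f0 fg; have g0 x : (0 <= g x)%E by exact: le_trans (fg x).
rewrite !ge0_integralTE//; apply: le_ereal_sup => _ [h hf <-].
by exists h => // x; exact: le_trans (hf x) (fg x).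
Qed.

Section heat_process.
Context (R : realType) (d : measure_display) (Omega : measurableType d)
  (P : probability Omega R) (W : set (spacetime R) -> Omega -> R)
  (hW : white_noise P W) (x : R) (F : R -> Omega -> R)
  (hF : heat_process P W x F).

Lemma heat_noise_limit t : 0 <= t -> noise_limit P W (F t).
Proof. by move=> t0; exact: (noise_limit_wiener (hF.1 t t0)). Qed.

Lemma heat_process_cov s t : 0 <= s -> 0 <= t ->
  (\int[P]_w (F s w * F t w))%R = heat_cov s t.
Proof.
wlog st : s t / s <= t => [H s0 t0|s0 t0].
  have [st|ts] := leP s t; first exact: H.
  rewrite heat_covC -H//; last exact: ltW.
  by apply: eq_Rintegral => w _; rewrite mulrC.
have ws := hF.1 s s0; have wt := hF.1 t t0.
have := white_noise_isometry hW ws wt.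
rewrite heat_integrand_inner_product//; last 2 first.
- by have [[]] := ws.
- by have [[]] := wt.
rewrite unlock /Rintegral => ->/=.
by rewrite /heat_cov ger0_norm ?subr_ge0// (addrC s t).
Qed.

Lemma heat_process_measurable t : 0 <= t -> measurable_fun setT (F t).
Proof. by move=> t0; have [_ mF _] := hF.1 t t0. Qed.

Lemma heat_moments8 t : 0 <= t -> moments8 P (F t).
Proof.
by move=> t0; have [] := gaussian_moments_real (noise_limit_moments hW (heat_noise_limit t0)).
Qed.

Context (p : time_partition R).

Let X i w : R := F (p i.+1) w - F (p i) w.

Lemma heat_increment_noise_limit i : noise_limit P W (X i).
Proof.
have -> : X i = (fun w => 1 * F (p i.+1) w + (-1) * F (p i) w).
  by apply/funext => w; rewrite mul1r mulN1r.
by apply: (noise_limit_lincomb hW); apply: heat_noise_limit; exact: knot_ge0.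
Qed.

Lemma heat_increment_gaussian i j a b : gaussian_moments P (fun w => a * X i w + b * X j w).
Proof.
apply: (noise_limit_moments hW).
by apply: (noise_limit_lincomb hW); exact: heat_increment_noise_limit.
Qed.

Lemma heat_increment_cov i j : (\int[P]_w (X i w * X j w))%R = knot_cov p i j.
Proof.
have iF k l : P.-integrable setT (EFin \o (fun w => F (p k) w * F (p l) w)).
  by apply: (@integrable_monomial _ _ _ _ _ _ 1 1) => //; apply: heat_moments8; exact: knot_ge0.
rewrite (@eq_Rintegral _ _ _ _ _ (fun w =>
  1 * (1 * (F (p i.+1) w * F (p j.+1) w) + (-1) * (F (p i.+1) w * F (p j) w)) +
  1 * ((-1) * (F (p i) w * F (p j.+1) w) + 1 * (F (p i) w * F (p j) w)))); last first.
  by move=> w _; rewrite /X; ring.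
rewrite Rintegral_lincomb; [|exact: integrable_lincomb..].
rewrite !Rintegral_lincomb// !heat_process_cov ?knot_ge0//.
by rewrite /knot_cov /heat_incr_cov; ring.
Qed.

Lemma heat_increment_var i : (\int[P]_w (X i w ^+ 2))%R = knot_var p i.
Proof. exact: heat_increment_cov. Qed.

Lemma knot_var_ge0 i : 0 <= knot_var p i.
Proof. by rewrite -heat_increment_var; apply: Rintegral_ge0 => w _; exact: sqr_ge0. Qed.

Lemma measurable_quartic_variation t :
  measurable_fun setT (fun w => quartic_variation F p t w).
Proof.
under eq_fun do rewrite quartic_variationE.
apply: measurable_sum => i; apply: measurable_funX; apply: measurable_funB;
  by apply: heat_process_measurable; exact: knot_ge0.
Qed.

(** The error splits into the centred sum of the X_i^4 - 3 A_i^2, of variance at most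
    192 delta t, and a deterministic part c made of the bias of the variances and
    of the piece of [0, t] after the last partition point. *)
Lemma quartic_variation_L2 (delta t : R) : 0 < delta -> delta <= 1 ->
  (mesh p < delta%:E)%E -> 0 <= t ->
  (\int[P]_w ((quartic_variation F p t w - 6 / pi * t) ^+ 2)%:E <=
    ((528 * t + 36) * delta)%:E)%E.
Proof.
move=> d0 d1 md t0; have p0 : 0 < pi :> R := pi_gt0 R.
set n := knot_count p t.
have [pn _] : p n <= t /\ _ := knot_countP p t0.
have pn1 : t < p n.+1 := knot_count_gt p t0.
have pn0 := knot_ge0 p n.
pose A := knot_var p; pose r := knot_cov p.
pose S w := \sum_(i < n) (X i w ^+ 4 - 3 * A i ^+ 2).
pose c := \sum_(i < n) 3 * A i ^+ 2 - 6 / pi * t.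
have Ad i : A i ^+ 2 <= p i.+1 - p i.
  have le := knot_nondecreasing p (leqnSn i).
  rewrite -[leRHS]sqr_sqrtr ?subr_ge0// ler_sqr ?nnegrE ?sqrtr_ge0 ?knot_var_ge0//.
  exact: knot_var_le_sqrt.
have AM i : 0 <= A i <= Num.sqrt delta.
  rewrite knot_var_ge0/= (le_trans (knot_var_le_sqrt p i))// ler_wsqrtr// ltW//.
  exact: knot_step_lt.
have [Si SE] := @quartic_sum_variance _ _ _ P n X A r heat_increment_gaussian
  heat_increment_var heat_increment_cov.
have m8 i : moments8 P (X i).
  by have [] := gaussian_moments_real (noise_limit_moments hW (heat_increment_noise_limit i)).
have S2 : (\int[P]_w (S w ^+ 2)%:E <= (192 * delta * t)%:E)%E.
  rewrite (@integral_Rintegral _ _ _ P (fun w => S w ^+ 2))// lee_fin SE.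
  apply: le_trans (@quartic_variance_le _ n A r (Num.sqrt delta) _ _ _) _.
  - by move=> i _; exact: AM.
  - move=> i j; apply: (@sqr_covariance_le _ _ _ P (X i) (X j)) => //;
      [exact: heat_increment_var|exact: heat_increment_var|exact: heat_increment_cov].
  - by move=> i ni; apply: sum_norm_knot_cov => //; exact: knot_var_ge0.
  rewrite sqr_sqrtr ?(ltW d0)// ler_wpM2l ?mulr_ge0 ?(ltW d0)//.
  apply: le_trans pn; rewrite -[leRHS]subr0 -[X in _ - X](knot0 p).
  rewrite -(knot_telescope p id n).
  by apply: ler_sum => i _; exact: Ad.
have cE : c ^+ 2 <= (72 * t + 18) * delta.
  have h1 : `|\sum_(i < n) 3 * A i ^+ 2 - 6 / pi * p n| <= 6 * (Num.sqrt delta * Num.sqrt t).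
    apply: le_trans (knot_var_bias n knot_var_ge0 md) _.
    by rewrite -mulrA ler_wpM2l// ler_wpM2l ?sqrtr_ge0// ler_wsqrtr.
  have pi3 : 6 / pi <= 3 :> R by rewrite ler_pdivrMr//; have := pi_ge2 R; lra.
  have h2 : 0 <= 6 / pi * (t - p n) <= 3 * delta.
    rewrite mulr_ge0 ?subr_ge0// ?divr_ge0 ?(ltW p0)//=.
    apply: ler_pM => //; rewrite ?subr_ge0// ?divr_ge0 ?(ltW p0)//.
    by have := knot_step_lt n md; lra.
  have c2 : c ^+ 2 <= 2 * (6 * (Num.sqrt delta * Num.sqrt t)) ^+ 2 + 2 * (3 * delta) ^+ 2.
    have cD : c = (\sum_(i < n) 3 * A i ^+ 2 - 6 / pi * p n) - 6 / pi * (t - p n).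
      by rewrite /c; ring.
    rewrite cD; move: h1 h2; move: (\sum_(i < n) _ - _) (6 / pi * (t - p n)) => u v.
    rewrite -ler_sqr ?nnegrE ?mulr_ge0 ?sqrtr_ge0// real_normK ?num_real// => hu /andP[v0 hv].
    have : v ^+ 2 <= (3 * delta) ^+ 2 by rewrite lerXn2r ?nnegrE// (le_trans v0).
    have := sqr_ge0 (u + v).
    rewrite !expr2 in hu *; nra.
  apply: le_trans c2 _; rewrite !exprMn !sqr_sqrtr ?(ltW d0)//.
  have : delta ^+ 2 <= delta by rewrite expr2 ler_piMl// ltW.
  rewrite !expr2; nra.
have mS : measurable_fun setT S.
  apply: measurable_sum => i; apply: measurable_funB => //.
  by apply: measurable_funX; have [] := m8 i.
apply: (@le_trans _ _ (2%:E * \int[P]_w (S w ^+ 2)%:E + (2 * c ^+ 2)%:E * \int[P]_w (1 : R)%:E)%E).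
  apply: integral_le_lincomb => //.
  - apply: measurable_funX; apply: measurable_funB => //.
    exact: measurable_quartic_variation.
  - exact: measurable_funX.
  - by move=> *; exact: sqr_ge0.
  - by move=> *; exact: sqr_ge0.
  - by rewrite mulr_ge0// sqr_ge0.
  - move=> w; rewrite quartic_variationE -/n.
    have -> : \sum_(i < n) (F (p i.+1) w - F (p i) w) ^+ 4 - 6 / pi * t = S w + c.
      by rewrite /S /c sumrB; ring.
    by have := sqr_ge0 (S w - c); rewrite !expr2; nra.
rewrite integral_cst//= probability_setT mule1.
apply: (@le_trans _ _ (2%:E * (192 * delta * t)%:E + (2 * c ^+ 2)%:E)%E).
  rewrite mule1; apply: leeD => //.
  by apply: lee_wpmul2l.
by rewrite -EFinM -EFinD lee_fin; move: cE; rewrite expr2; nra.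
Qed.

End heat_process.

(** * From fixed times to the supremum *)

(** If k h <= t < (k+1) h then monotonicity of V squeezes V t - c t between the
    deviations at the two grid points, up to c h.  The grid has K + 2 points since
    t = T requires the point (K+1) h beyond T. *)
Lemma sqr_deviation_le_grid (R : realType) (V : R -> R) (c T : R) (K : nat) (t : R) :
  0 <= c -> 0 < T -> (0 < K)%N ->
  (forall s u, 0 <= s -> s <= u -> V s <= V u) -> 0 <= t <= T ->
  (V t - c * t) ^+ 2 <=
    2 * (\sum_(k < K.+2) (V (k%:R * (T / K%:R)) - c * (k%:R * (T / K%:R))) ^+ 2)
    + 2 * (c * (T / K%:R)) ^+ 2.
Proof.
move=> c0 T0 K0 ndV /andP[t0 tT].
set h := T / K%:R.
have h0 : 0 < h by rewrite divr_gt0// ltr0n.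
set D := fun k : nat => V (k%:R * h) - c * (k%:R * h).
pose k := Num.truncn (t / h).
have /andP[kt tk] : k%:R * h <= t < k.+1%:R * h.
  rewrite -ler_pdivlMr// -ltr_pdivrMr//.
  by rewrite truncn_itv// divr_ge0// ltW.
have kK : (k <= K)%N.
  rewrite -(ler_nat R); apply: (@le_trans _ _ (t / h)); first by rewrite ler_pdivlMr.
  by rewrite ler_pdivrMr// /h mulrCA divff ?mulr1// gt_eqF// ltr0n.
have term j : (j < K.+2)%N -> D j ^+ 2 <= \sum_(k < K.+2) D k ^+ 2.
  move=> jK; rewrite (bigD1 (Ordinal jK))//= lerDl.
  by apply: sumr_ge0 => i _; exact: sqr_ge0.
have hk : k.+1%:R * h = k%:R * h + h by rewrite -natr1 mulrDl mul1r.
have kh0 : 0 <= k%:R * h by rewrite mulr_ge0// ltW.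
have lo : D k - c * h <= V t - c * t.
  have := ndV _ _ kh0 kt; rewrite /D.
  have : c * t <= c * (k%:R * h + h) by rewrite ler_wpM2l// -hk ltW.
  lra.
have up : V t - c * t <= D k.+1 + c * h.
  have := ndV _ _ t0 (ltW tk); rewrite /D hk.
  have : c * (k%:R * h) <= c * t by rewrite ler_wpM2l.
  lra.
have ch0 : 0 <= c * h by rewrite mulr_ge0// ltW.
have [v0|v0] := leP 0 (V t - c * t).
  have := term k.+1; rewrite !ltnS => /(_ kK).
  move: (V t - c * t) (D k.+1) (c * h) (\sum_(_ < _) _) v0 up ch0 => v e g S v0 up g0 eS.
  have : v ^+ 2 <= (e + g) ^+ 2 by rewrite lerXn2r ?nnegrE// (le_trans v0).
  by have := sqr_ge0 (e - g); rewrite !expr2 in eS *; nra.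
have := term k; rewrite ltnS leqW// => /(_ isT).
move: (V t - c * t) (D k) (c * h) (\sum_(_ < _) _) v0 lo ch0 => v e g S v0 lo g0 eS.
have : (- v) ^+ 2 <= (- e + g) ^+ 2 by rewrite lerXn2r ?nnegrE//; lra.
by have := sqr_ge0 (e + g); rewrite !expr2 in eS *; nra.
Qed.

Lemma integral_sum_le (R : realType) (d : measure_display) (T : measurableType d)
    (mu : {measure set T -> \bar R}) (n : nat) (f : nat -> T -> R) (b : R) :
  (forall k, measurable_fun setT (f k)) -> (forall k w, 0 <= f k w) ->
  (forall k, (k < n)%N -> (\int[mu]_w (f k w)%:E <= b%:E)%E) ->
  (\int[mu]_w (\sum_(k < n) f k w)%:E <= (n%:R * b)%:E)%E.
Proof.
move=> mf f0 fb.
under eq_integral do rewrite -sumEFin.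
rewrite ge0_integral_sum//; last 2 first.
- by move=> k; exact/measurable_EFinP.
- by move=> k w _; rewrite lee_fin.
apply: (@le_trans _ _ (\sum_(k < n) b%:E)%E).
  by apply: lee_sum => k _; exact: fb.
by rewrite sumEFin lee_fin sumr_const card_ord mulr_natl.
Qed.

Unset Implicit Arguments.

Theorem theorem2p3 (R : realType) (d : measure_display)
    (Omega : measurableType d) (P : probability Omega R)
    (W : set (spacetime R) -> Omega -> R) (hW : white_noise P W)
    (x : R) (F : R -> Omega -> R) (hF : heat_process P W x F) :
  forall T : R, 0 < T ->
  forall eps : R, 0 < eps ->
  exists2 delta : R, 0 < delta &
    forall p : time_partition R, (mesh p < delta%:E)%E ->
      (\int[P]_w
         ereal_sup
           [set (`|quartic_variation F p t w - 6 / pi * t| ^+ 2)%:E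
              | t in `[0%R, T]]
       < eps%:E)%E.
Proof.
move=> T T0 eps eps0; have p0 : 0 < pi :> R := pi_gt0 R.
set c : R := 6 / pi.
have c0 : 0 <= c by rewrite /c divr_ge0// ltW.
(* the grid step h is such that c h <= e1, hence 2 (c h) ^+ 2 <= eps / 4 *)
pose e1 : R := Num.min 1 (eps / 8).
have e10 : 0 < e1 by rewrite lt_min ltr01 divr_gt0.
pose K := (Num.truncn (c * T / e1)).+1.
have K0 : 0 < K%:R :> R by rewrite ltr0n.
pose h := T / K%:R.
have h0 : 0 < h by rewrite divr_gt0.
have hT : h <= T by rewrite ler_pdivrMr// ler_peMr ?(ltW T0)// ler1n.
have ch : c * h <= e1.
  by rewrite /h mulrA ler_pdivrMr// [leRHS]mulrC -ler_pdivrMr// ltW// truncnS_gt.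
have ch2 : 2 * (c * h) ^+ 2 <= eps / 4.
  have ch0 : 0 <= c * h by rewrite mulr_ge0// ltW.
  have ch1 : c * h <= 1 by rewrite (le_trans ch)// ge_min lexx.
  have : c * h <= eps / 8 by rewrite (le_trans ch)// ge_min lexx orbT.
  have : (c * h) ^+ 2 <= c * h by rewrite expr2 ler_piMl.
  lra.
(* the last grid point (K+1) h is at most 2 T *)
pose B := 2 * (K.+2%:R * (528 * (2 * T) + 36)).
have B0 : 0 < B.
  have C0 : 0 < 528 * (2 * T) + 36 by lra.
  by rewrite /B (mulr_gt0 (ltr0n _ 2))// (mulr_gt0 _ C0)// ltr0n.
pose delta := Num.min 1 (eps / 2 / B).
have d0 : 0 < delta by rewrite lt_min ltr01 (divr_gt0 _ B0)// divr_gt0.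
have d1 : delta <= 1 by rewrite ge_min lexx.
have dB : B * delta <= eps / 2.
  by rewrite mulrC -ler_pdivlMr// ge_min lexx orbT.
exists delta => // p md.
pose D k w := (quartic_variation F p (k%:R * h) w - c * (k%:R * h)) ^+ 2.
have grid0 k : 0 <= k%:R * h by rewrite mulr_ge0// ltW.
have mD k : measurable_fun setT (D k).
  apply: measurable_funX; apply: measurable_funB => //.
  exact: (measurable_quartic_variation hF).
have D0 k w : 0 <= D k w by exact: sqr_ge0.
have Dle k : (k < K.+2)%N ->
    (\int[P]_w (D k w)%:E <= ((528 * (2 * T) + 36) * delta)%:E)%E.
  move=> kK; apply: le_trans (quartic_variation_L2 hW hF d0 d1 md (grid0 k)) _.
  rewrite lee_fin ler_wpM2r ?(ltW d0)// lerD2r ler_wpM2l//.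
  apply: (@le_trans _ _ (K.+1%:R * h)).
    by rewrite ler_wpM2r ?(ltW h0)// ler_nat -ltnS.
  have Kh : K%:R * h = T by rewrite /h mulrCA divff ?mulr1// gt_eqF.
  by rewrite -natr1 mulrDl Kh mul1r; lra.
apply: (@le_lt_trans _ _ (\int[P]_w
    (2 * (\sum_(k < K.+2) D k w) + 2 * (c * h) ^+ 2)%:E)%E).
  apply: nneg_le_integral => w.
    apply: (@le_trans _ _ (`|quartic_variation F p 0 w - c * 0| ^+ 2)%:E).
      by rewrite lee_fin exprn_ge0.
    by apply: ereal_sup_ubound; exists 0 => //=; rewrite in_itv/= lexx ltW.
  apply: ge_ereal_sup => _ [t /= + <-]; rewrite in_itv/= => tT.
  rewrite lee_fin real_normK ?num_real//.
  apply: (@sqr_deviation_le_grid _ (fun t => quartic_variation F p t w)) => //.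
  by move=> s u; exact: quartic_variation_nondecreasing.
apply: (@le_lt_trans _ _ (2%:E * \int[P]_w (\sum_(k < K.+2) D k w)%:E +
    (2 * (c * h) ^+ 2)%:E * \int[P]_w (1 : R)%:E)%E).
  have mS : measurable_fun setT (fun w => \sum_(k < K.+2) D k w) by exact: measurable_sum.
  have S0 w : 0 <= \sum_(k < K.+2) D k w by apply: sumr_ge0 => k _; exact: D0.
  have ch0 : 0 <= 2 * (c * h) ^+ 2 by rewrite mulr_ge0// sqr_ge0.
  apply: integral_le_lincomb => //.
  - by apply: measurable_funD => //; exact: measurable_funM.
  - by move=> w; rewrite addr_ge0// mulr_ge0.
  - by move=> w; rewrite mulr1.
rewrite integral_cst//= probability_setT mule1 mule1.
apply: (@le_lt_trans _ _ (2%:E * (K.+2%:R * ((528 * (2 * T) + 36) * delta))%:E +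
    (2 * (c * h) ^+ 2)%:E)%E).
  apply: leeD => //; apply: lee_wpmul2l => //.
  exact: integral_sum_le.
rewrite -EFinM -EFinD lte_fin.
rewrite (_ : 2 * (K.+2%:R * ((528 * (2 * T) + 36) * delta)) = B * delta); last first.
  by rewrite /B !mulrA.
lra.
Qed.
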